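(* Let $\pi=u'_0x_1^{\omega+q_1}u_1x_2^{\omega+q_2}\cdots x_m^{\omega+q_m}u_m$ and $\rho=u'_mx_{m+1}^{\omega+q_{m+1}}u_{m+1}\cdots x_n^{\omega+q_n}u_n$ (with $1\le m<n$, all $u$'s in $A^*$, all $x_i\in A^+$, all $q_i\in\mathbb Z$) be $\kappa$-terms of rank 1, each in canonical form, and let $\mathsf w_\pi,\mathsf w_\rho$ and $S_{\pi,\rho}$ be constructed as in the context (for any admissible choices made there). The following are equivalent: (a) every finite semigroup satisfies $\pi=\rho$; (b) every finite local group satisfies $\pi=\rho$; (c) $S_{\pi,\rho}$ satisfies $\pi=\rho$; (d) $\mathsf w_\pi$ and $\mathsf w_\rho$ are the same word, $u'_0=u'_m$ and $u_m=u_n$; (e) $\pi$ and $\rho$ are the same $\kappa$-term.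
   Context: $\kappa$-terms over an alphabet $A$ are formal expressions built from letters by binary concatenation and the unary $(\omega-1)$-power; the rank is the maximal nesting depth of $(\omega-1)$-powers. In a finite semigroup, $s^\omega$ is the idempotent power of $s$ and $s^{\omega-1}$ is the inverse of $s^{\omega+1}=ss^\omega$ in the maximal subgroup with identity $s^\omega$. Notation: $x^{\omega+0}=x^\omega$ (i.e. $x^{\omega-1}x$), $x^{\omega+n}=x^\omega x^n$ and $x^{\omega-n}=(x^{\omega-1})^n$ for $n>0$. A finite semigroup $S$ satisfies $\pi=\rho$ if $\pi,\rho$ have the same value under every map $A\to S$. A local group is a semigroup $S$ with $eSe$ a group for each idempotent $e$. Fix a total order on $A$; a Lyndon word is a primitive word that is lexicographically minimal in its conjugacy class. A rank 1 $\kappa$-term $u_0x_1^{\omega+q_1}u_1\cdots x_k^{\omega+q_k}u_k$ is in canonical form if (i) each $x_i$ is a Lyndon word; (ii) $x_i$ is not a suffix of $u_{i-1}$ ($1\le i\le k$); (iii) $x_i$ is not a prefix of $u_ix_{i+1}^{|x_i|}$ ($1\le i\le k$), where $x_{k+1}$ is the empty word. Take $A$ to be the set of letters occurring in $\pi$ or $\rho$. Let $I_n=\{1,\dots,n\}$, $I_{m,n}=I_n\setminus\{m,n\}$; for $i\in I_n$ let $\ell_i=|x_i|$, $x_i=a_{i1}\cdots a_{i\ell_i}$ and $x_{ij}=a_{ij}\cdots a_{i\ell_i}a_{i1}\cdots a_{i,j-1}$ ($1\le j\le\ell_i$). Let $\mathbb q=1+\max\{|q_i|:i\in I_n\}$,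 $\mathbb q_i=\mathbb q+q_i$. Introduce variables $\mathsf v_x$ ($x\in A^+$) and $\mathsf v_{x,u,y}$ (triples of words), let $\mathsf V=\{\mathsf v_{x_i}:i\in I_n\}\cup\{\mathsf v_{x_j,u_j,x_{j+1}}:j\in I_{m,n}\}$ and $\mathsf w_\pi=\mathsf u'_0\mathsf v_{x_1}^{\mathbb q_1}\mathsf v_{x_1,u_1,x_2}\mathsf v_{x_2}^{\mathbb q_2}\cdots\mathsf v_{x_{m-1},u_{m-1},x_m}\mathsf v_{x_m}^{\mathbb q_m}\mathsf u_m$, $\mathsf w_\rho=\mathsf u'_m\mathsf v_{x_{m+1}}^{\mathbb q_{m+1}}\mathsf v_{x_{m+1},u_{m+1},x_{m+2}}\cdots\mathsf v_{x_{n-1},u_{n-1},x_n}\mathsf v_{x_n}^{\mathbb q_n}\mathsf u_n$, where $\mathsf u'_0,\mathsf u_m,\mathsf u'_m,\mathsf u_n$ are respectively $\mathsf v_{x_1},\mathsf v_{x_m},\mathsf v_{x_{m+1}},\mathsf v_{x_n}$ if $u'_0,u_m,u'_m,u_n$ is non-empty and the empty word otherwise. Choose a homomorphism $\eta$ from the free group on $\mathsf V$ to a finite group $G$, writing $g_*=\eta(\mathsf v_* )$, such that every $g_*$ has order at least $2\mathbb q$ and, if $\mathsf w_\pi\ne\mathsf w_\rho$ as words, then $\eta(\mathsf w_\pi)\ne\eta(\mathsf w_\rho)$. Choose an integer $\mathbb i>|u'_0x_1u_1\cdots x_mu_m|+|u'_mx_{m+1}u_{m+1}\cdots x_nu_n|$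 and set $W_{\mathbb i}=\{u'_0x_1^{\mathbb i},u'_mx_{m+1}^{\mathbb i},x_m^{\mathbb i}u_m,x_n^{\mathbb i}u_n\}$. Choose $\mathbb j>\mathbb i$ such that for all $i,i'\in I_{m,n}$ the word $x_i^{\mathbb j}u_ix_{i+1}^{\mathbb j}$ has at most one occurrence in the bi-infinite word $\cdots x_{i'}x_{i'}u_{i'}x_{i'+1}x_{i'+1}\cdots$, and set $W_{\mathbb j}=\{x_i^{\mathbb j}u_ix_{i+1}^{\mathbb j}:i\in I_{m,n}\}$ (empty if $n=2$). Choose $\mathbb k>\mathbb j$ such that no $x_{iq}^{\mathbb k}$ is a factor of a word of $W_{\mathbb j}$ and $\mathbb k+1+\mathbb q$ is a multiple of the order of each $g_{x_i}$ ($i\in I_n$); set $W_{\mathbb k}=\{x_{iq}^{\mathbb k}:i\in I_n,1\le q\le\ell_i\}$, $W'_{\mathbb k}=\{x_1^{\mathbb k},\dots,x_n^{\mathbb k}\}$, and let $L$ be the set of non-empty factors of words of $W_{\mathbb i}\cup W_{\mathbb j}\cup W_{\mathbb k}$. For $v\in A^+$ of length $\ell\ge2$ let $v_\alpha,v_\omega$ be its prefix and suffix of length $\ell-1$, and $\ddot L=\{v\in A^+:v\notin L,\ v_\alpha,v_\omega\in L\}$. Define $\mathsf f:L\cup\ddot L\to G$ by $\mathsf f(w)=g_{x_i}^{-1}g_{x_i,u_i,x_{i+1}}g_{x_{i+1}}^{-t_i-1}$ if $w=x_i^{\mathbb j}u_ix_{i+1}^{\mathbb j}\in W_{\mathbb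 j}$, where $t_i\ge0$ is the largest integer with $x_{i+1}^{t_i}$ a suffix of $x_i^{\mathbb j}u_i$; $\mathsf f(w)=g_{x_i}$ if $w=x_i^{\mathbb k}\in W'_{\mathbb k}$; $\mathsf f(w)=1_G$ otherwise. Finally $S_{\pi,\rho}$ is the semigroup with generators $A\cup G$ (disjoint) and relations $g\,h=(gh)$ ($g,h\in G$), $1_G\,u\,1_G=\mathsf f(u)$ ($u\in L$), $v=v_\alpha\,\mathsf f(v)\,v_\omega$ ($v\in\ddot L$); it is a finite local group. *)

(* Defs.v *)
From HB Require Import structures.
From mathcomp Require Import all_boot all_order all_algebra all_fingroup.
Set Implicit Arguments. Unset Strict Implicit. Unset Printing Implicit Defensive.
Import Order.TTheory GRing.Theory Num.Theory.

Definition spow (T : Type) (op : T -> T -> T) (s : T) (k : nat) : T :=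
  iter k.-1 (op s) s.

(* In a finite semigroup with N := #|T|`!, s^N is the idempotent power s^omega
   and s^(2N-1) is the inverse of s^(omega+1) in the maximal subgroup at s^omega. *)
Definition omega_m1 (T : finType) (op : T -> T -> T) (s : T) : T :=
  spow op s (2 * (#|T|)`! - 1).

(* the semigroup with an identity adjoined (None = empty product) *)
Definition oprod (T : Type) (op : T -> T -> T) (a b : option T) : option T :=
  match a, b with
  | None, _ => b
  | _, None => a
  | Some x, Some y => Some (op x y)
  end.

(* eSe is a group for each idempotent e (its identity is necessarily e) *)
Definition local_group (T : Type) (op : T -> T -> T) : Prop :=
  forall e, op e e = e -> forall s, exists t,
    op (op (op e s) e) (op (op e t) e) = e /\ op (op (op e t) e) (op (op e s) e) = e.

(* kappa-terms (modulo associativity of concatenation)                *)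
(* A kappa-term is a non-empty sequence of items, an item being a     *)
(* letter or the (omega-1)-power of a kappa-term.                      *)
Inductive kitem (A : Type) := KLet of A | KPow of seq (kitem A).
Arguments KLet {A}.
Arguments KPow {A}.
Definition kterm (A : Type) := seq (kitem A).

Fixpoint keval (A : Type) (T : finType) (op : T -> T -> T) (phi : A -> T)
    (t : kitem A) : option T :=
  match t with
  | KLet a => Some (phi a)
  | KPow s =>
      let fix evs (s : seq (kitem A)) : option T :=
        match s with [::] => None | t :: s' => oprod op (keval op phi t) (evs s') end
      in omap (omega_m1 op) (evs s)
  end.

Definition kevals (A : Type) (T : finType) (op : T -> T -> T) (phi : A -> T)
    (s : kterm A) : option T :=
  foldr (fun t acc => oprod op (keval op phi t) acc) None s.

Definition satisfies (A : Type) (T : finType) (op : T -> T -> T) (pi rho : kterm A) : Prop :=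
  forall phi : A -> T, kevals op phi pi = kevals op phi rho.

Definition wpow (A : Type) (x : seq A) (k : nat) : seq A := flatten (nseq k x).

Fixpoint lexle (d : Order.disp_t) (A : orderType d) (s t : seq A) : bool :=
  match s, t with
  | [::], _ => true
  | _ :: _, [::] => false
  | a :: s', b :: t' => (a < b)%O || ((a == b) && lexle s' t')
  end.

Definition primitive (A : eqType) (x : seq A) : Prop :=
  x != [::] /\ forall (y : seq A) (k : nat), 1 < k -> x != wpow y k.

Definition lyndon (d : Order.disp_t) (A : orderType d) (x : seq A) : Prop :=
  primitive x /\ forall i, i < size x -> lexle x (rot i x).

(* x^(omega+q) as a kappa-term:  x^(omega+k) = x^(omega-1) x^(k+1) (k >= 0),
   x^(omega-k) = (x^(omega-1))^k (k > 0) *)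
Definition kpow_term (A : Type) (x : seq A) (q : int) : kterm A :=
  match q with
  | Posz k => KPow (map KLet x) :: map KLet (wpow x k.+1)
  | Negz k => nseq k.+1 (KPow (map KLet x))
  end.

Definition build (A : Type) (u0 : seq A) (blocks : seq (seq A * int * seq A)) : kterm A :=
  map KLet u0 ++ flatten [seq kpow_term b.1.1 b.1.2 ++ map KLet b.2 | b <- blocks].

Fixpoint canonical_aux (d : Order.disp_t) (A : orderType d) (prevu : seq A)
    (blocks : seq (seq A * int * seq A)) : Prop :=
  match blocks with
  | [::] => True
  | b :: rest =>
      let nx := if rest is b' :: _ then b'.1.1 else [::] in
      [/\ lyndon b.1.1, ~~ suffix b.1.1 prevu,
          ~~ prefix b.1.1 (b.2 ++ wpow nx (size b.1.1)) & canonical_aux b.2 rest]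
  end.

Definition canonical (d : Order.disp_t) (A : orderType d) (u0 : seq A)
    (blocks : seq (seq A * int * seq A)) : Prop := canonical_aux u0 blocks.

Record rdata (A : Type) := RData {
  rm : nat; rn : nat; ru0' : seq A; rum' : seq A;
  rx : nat -> seq A; ru : nat -> seq A; rq : nat -> int }.

Section Construction.
Context (d : Order.disp_t) (A : orderType d) (D : rdata A).
Local Notation m := (rm D).
Local Notation n := (rn D).
Local Notation x := (rx D).
Local Notation u := (ru D).
Local Notation q := (rq D).

Definition blocks (a b : nat) : seq (seq A * int * seq A) :=
  [seq (x i, q i, u i) | i <- iota a (b - a).+1].

Definition kpi : kterm A := build (ru0' D) (blocks 1 m).
Definition krho : kterm A := build (rum' D) (blocks m.+1 n).

Definition In : seq nat := iota 1 n.
Definition Imn : seq nat := [seq i <- In | (i != m) && (i != n)].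

Definition occ : seq A := ru0' D ++ rum' D ++ flatten [seq x i ++ u i | i <- In].

(* variables: inl x = v_x, inr (x,u,y) = v_{x,u,y} *)
Definition var := (seq A + seq A * seq A * seq A)%type.

Definition qq : nat := (\max_(i <- In) absz (q i)).+1.
Definition qi (i : nat) : nat := absz (qq%:Z + q i)%R.

Definition vblock (a b : nat) : seq var :=
  flatten [seq nseq (qi i) (inl (x i)) ++
               (if i < b then [:: inr (x i, u i, x i.+1)] else [::])
          | i <- iota a (b - a).+1].

Definition wpi : seq var :=
  (if ru0' D != [::] then [:: inl (x 1)] else [::]) ++ vblock 1 m ++
  (if u m != [::] then [:: inl (x m)] else [::]).
Definition wrho : seq var :=
  (if rum' D != [::] then [:: inl (x m.+1)] else [::]) ++ vblock m.+1 n ++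
  (if u n != [::] then [:: inl (x n)] else [::]).

Definition Vset : seq var :=
  [seq inl (x i) | i <- In] ++ [seq inr (x j, u j, x j.+1) | j <- Imn].

Context (gT : finGroupType) (g : var -> gT) (ii jj kk : nat).

Definition eta (w : seq var) : gT := foldr (fun v acc => (g v * acc)%g) 1%g w.

Definition eta_ok : Prop :=
  (forall v, v \in Vset -> 2 * qq <= #[g v]%g) /\
  (wpi != wrho -> eta wpi != eta wrho).

Definition ii_ok : Prop :=
  size (ru0' D ++ flatten [seq x i ++ u i | i <- iota 1 m]) +
  size (rum' D ++ flatten [seq x i ++ u i | i <- iota m.+1 (n - m)]) < ii.

(* the bi-infinite word ... x x u y y ... with u starting at position 0 *)
Definition biinf (xw uw yw : seq A) (p : int) : option A :=
  if (p < 0)%R then onth xw (absz (p %% (size xw)%:Z)%Z)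
  else if absz p < size uw then onth uw (absz p)
  else onth yw ((absz p - size uw) %% size yw).

Definition occurs_at (w xw uw yw : seq A) (p : int) : Prop :=
  forall k, k < size w -> biinf xw uw yw (p + k%:Z)%R = onth w k.

Definition Wj_i (i : nat) : seq A := wpow (x i) jj ++ u i ++ wpow (x i.+1) jj.

Definition jj_ok : Prop :=
  ii < jj /\
  forall i i', i \in Imn -> i' \in Imn -> forall p p' : int,
    occurs_at (Wj_i i) (x i') (u i') (x i'.+1) p ->
    occurs_at (Wj_i i) (x i') (u i') (x i'.+1) p' -> p = p'.

Definition Wi : seq (seq A) :=
  [:: ru0' D ++ wpow (x 1) ii; rum' D ++ wpow (x m.+1) ii;
      wpow (x m) ii ++ u m; wpow (x n) ii ++ u n].
Definition Wj : seq (seq A) := [seq Wj_i i | i <- Imn].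
(* x_{i,r+1} = rot r x_i *)
Definition Wk : seq (seq A) :=
  flatten [seq [seq wpow (rot r (x i)) kk | r <- iota 0 (size (x i))] | i <- In].

Definition kk_ok : Prop :=
  [/\ jj < kk,
      (forall i, i \in In -> forall r, r < size (x i) -> forall w, w \in Wj ->
         ~~ infix (wpow (rot r (x i)) kk) w) &
      (forall i, i \in In -> (#[g (inl (x i))]%g %| kk + 1 + qq)%N)].

Definition inL (w : seq A) : bool :=
  (w != [::]) && has (fun z => infix w z) (Wi ++ Wj ++ Wk).

Definition inLdd (v : seq A) : bool :=
  [&& 1 < size v, ~~ inL v, inL (take (size v).-1 v) & inL (behead v)].

Definition tt (i : nat) : nat :=
  let w := wpow (x i) jj ++ u i in
  \max_(t < (size w).+1 | suffix (wpow (x i.+1) t) w) t.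

Definition fW (i : nat) : gT :=
  ((g (inl (x i)))^-1 * g (inr (x i, u i, x i.+1)) * (g (inl (x i.+1))) ^- (tt i).+1)%g.

Definition fval (w : seq A) : gT :=
  match [seq i <- Imn | w == Wj_i i] with
  | i :: _ => fW i
  | [::] => match [seq i <- In | w == wpow (x i) kk] with
            | i :: _ => g (inl (x i))
            | [::] => 1%g
            end
  end.

Definition wprod (T : Type) (op : T -> T -> T) (iA : A -> T) (w : seq A) : option T :=
  foldr (fun a acc => oprod op (Some (iA a)) acc) None w.

Definition relations_hold (T : Type) (op : T -> T -> T) (iA : A -> T) (iG : gT -> T) : Prop :=
  [/\ (forall a b : gT, op (iG a) (iG b) = iG (a * b)%g),
      (forall w, inL w ->
         oprod op (oprod op (Some (iG 1%g)) (wprod op iA w)) (Some (iG 1%g))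
         = Some (iG (fval w))) &
      (forall v, inLdd v ->
         wprod op iA v =
         oprod op (oprod op (wprod op iA (take (size v).-1 v)) (Some (iG (fval v))))
                  (wprod op iA (behead v)))].

(* (T, op, iA, iG) is (a copy of) the semigroup S_{pi,rho} presented by the
   generators occ (letters) and gT and the relations above: it is generated by
   the generators, satisfies the relations, and is universal for that. *)
Definition is_S_pres (T : Type) (op : T -> T -> T) (iA : A -> T) (iG : gT -> T) : Prop :=
  [/\ relations_hold op iA iG,
      (forall t : T, exists s : seq (A + gT),
         [/\ s != [::], all (fun z => if z is inl a then a \in occ else true) s &
             foldr (fun z acc => oprod op (Some (match z with inl a => iA a | inr h => iG h end)) acc)
                   None s = Some t]) &
      (forall (T' : Type) (op' : T' -> T' -> T') (iA' : A -> T') (iG' : gT -> T'),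
         associative op' -> relations_hold op' iA' iG' ->
         exists h : T -> T',
           [/\ forall a b, h (op a b) = op' (h a) (h b),
               forall a, a \in occ -> h (iA a) = iA' a &
               forall z, h (iG z) = iG' z])].

End Construction.

(* Main.v *)
Require Import Defs.
From HB Require Import structures.
From mathcomp Require Import all_boot all_order all_algebra all_fingroup.
From mathcomp Require Import zify.
Set Implicit Arguments. Unset Strict Implicit. Unset Printing Implicit Defensive.

(** S_{pi,rho} has normal forms: a word of L, or p k s with p and s in L or empty
    and k in G; multiplying such a form on the right by a letter that leads out of L
    keeps the longest suffix in L and multiplies k by f of what was there before.
    As f is nontrivial only on words of W_j and W'_k, which are maximal in L, the
    element f(p) k f(s) attached to a word w is the product, over the prefixes of w,
    of f at the longest suffix lying in L.

    In a finite semigroup pi has the value of a word u0' x_1^M_1 u_1 ... x_m^M_m u_m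
    with M_i large and congruent to q_i modulo every group order.  By the Fine-Wilf
    theorem, a long power of a Lyndon word x_r can occur there only inside the run of
    an x_i = x_r, in phase with it; canonicity then forces the words of W_j and W'_k
    to occur only at the expected places.  Each x_i^kk contributes g_{x_i}, and the
    corrections in f on W_j together with the choice of kk turn the product into
    eta(w_pi), framed by the contributions of p and s.  So if S_{pi,rho} satisfies
    pi = rho, comparing k gives w_pi = w_rho, comparing p gives u0' = um' and
    comparing s gives u_m = u_n.

    S_{pi,rho} is a local group because 1 S 1 = G: some power of an idempotent e
    leaves L, so e = p k s, whence every element of e S e is of the form p h s with
    h in G, and right inverses can be computed in G. *)

(** * Periodicity and Lyndon words *)

(** A run of [M] copies of $x_i$ completes $x_i^{kk}$ at each copy from the [kk]-th on, which gives
    $g_{x_i}$ the exponent $M+1-kk$. As [kk + 1 + qq] vanishes modulo the order, this amounts to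
    $\mathbb q_i+2$: two factors too many. After a connecting word, $t_i$ copies of $x_{i+1}$
    already stand in front of the run and add $t_i$. On the left it is f(p) itself if $u_0'$ is
    empty, because then $p=x_1^{kk}$; otherwise f(p) = 1 and the factor stays in the middle, which
    is why $\mathsf w_\pi$ has an extra first letter exactly when $u_0'$ is non-empty. The obstacle
    is to show that distinct normal forms are distinct elements. Instead of proving a rewriting
    system confluent, normal forms are made the states of an automaton reading generators, and a
    product reads the second factor from the state of the first; associativity and universality then
    reduce to single steps. *)

Section FineWilf.
Variables (T : Type) (h : nat -> T).
Definition has_period p n := forall k, k + p < n -> h (k + p) = h k.

(** Since [p + q <= n], from each position one can either go forward by [q] and then back by [p], or
    back by [p] and then forward by [q], without leaving the range. *)
Lemma has_period_sub p q n : p <= q -> p + q <= n ->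
  has_period p n -> has_period q n -> has_period (q - p) n.
Proof.
move=> lepq len hp hq k kn.
case: (ltnP (k + q) n) => kq.
  rewrite -(hq k kq) -(hp (k + (q - p))); last by lia.
  by congr h; lia.
have kp : k = (k - p) + p by lia.
have -> : k + (q - p) = (k - p) + q by lia.
rewrite hq; last by lia.
by rewrite {2}kp hp //; lia.
Qed.

(** Subtractive Euclidean algorithm on the periods. The bound [p + q <= n], larger than the sharp
    one, survives every subtraction. *)
Lemma fine_wilf p q n : 0 < p -> 0 < q -> p + q <= n ->
  has_period p n -> has_period q n -> has_period (gcdn p q) n.
Proof.
elim: {p q}_.+1 {-2}p {-2}q (ltnSn (p + q)) => // N IH p q.
move=> ltN p0 q0 len hp hq.
case: (ltngtP p q) => [lt | lt | eq].
- have -> : gcdn p q = gcdn p (q - p).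
    by rewrite -[in LHS](subnKC (ltnW lt)) gcdnDl.
  by apply: IH; rewrite ?subn_gt0 //; [lia | lia | apply: has_period_sub => //; lia].
- have -> : gcdn p q = gcdn (p - q) q.
    by rewrite -[in LHS](subnKC (ltnW lt)) ![gcdn _ q]gcdnC gcdnDl.
  apply: IH; rewrite ?subn_gt0 //; [lia | lia |].
  by apply: has_period_sub => //; lia.
- by rewrite eq gcdnn.
Qed.
End FineWilf.

Section Words.
Variables (A : eqType) (a0 : A).
Implicit Types (x y u v w z : seq A).

Lemma wpowS x k : wpow x k.+1 = x ++ wpow x k. Proof. by []. Qed.
Lemma wpow1 x : wpow x 1 = x. Proof. by rewrite wpowS cats0. Qed.
Lemma wpowD x k l : wpow x (k + l) = wpow x k ++ wpow x l.
Proof. by rewrite /wpow nseqD flatten_cat. Qed.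
Lemma wpowSr x k : wpow x k.+1 = wpow x k ++ x.
Proof. by rewrite -addn1 wpowD wpow1. Qed.
Lemma size_wpow x k : size (wpow x k) = k * size x.
Proof. by elim: k => // k IH; rewrite wpowS size_cat IH mulSn. Qed.
Lemma nth_wpow x k i : i < k * size x ->
  nth a0 (wpow x k) i = nth a0 x (i %% size x).
Proof.
elim: k i => [|k IH] i //; rewrite wpowS mulSn nth_cat => ik.
case: ltnP => ix; first by rewrite modn_small.
by rewrite IH ?ltn_subLR // -(modnDr (i - size x)) subnK.
Qed.
Lemma mem_wpow x k : {subset wpow x k <= x}.
Proof. by elim: k => // k IH a; rewrite wpowS mem_cat => /orP[|/IH]. Qed.

(* The letter at position k of the bi-infinite word ...xxx... having a copy of x
   at position b; the shift by (|x|-1)b plays the role of -b modulo |x|. *)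
Definition anchored x b k := nth a0 x ((k + b * (size x).-1) %% size x).

Lemma modn_shift l b j : 0 < l -> (b + j + b * l.-1) %% l = j %% l.
Proof.
move=> l0; have -> : b + j + b * l.-1 = b * l + j by case: l l0 => //= l _; lia.
by rewrite modnMDl.
Qed.

Lemma anchoredE x b j : x != [::] -> anchored x b (b + j) = nth a0 x (j %% size x).
Proof. by move=> x0; rewrite /anchored modn_shift // lt0n size_eq0. Qed.

Lemma eq_anchored x b b' k : b = b' %[mod size x] -> anchored x b k = anchored x b' k.
Proof.
move=> e; rewrite /anchored; congr nth.
by apply/eqP; rewrite eqn_modDl -modnMml e modnMml.
Qed.

Lemma anchored_modl x b k k' : k = k' %[mod size x] -> anchored x b k = anchored x b k'.
Proof. by move=> e; rewrite /anchored -modnDml e modnDml. Qed.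

Lemma anchored_period x b k : anchored x b (k + size x) = anchored x b k.
Proof. by apply: anchored_modl; rewrite modnDr. Qed.

Lemma nth_wpow_anchored x M b k : x != [::] -> size x %| b ->
  k < M * size x -> nth a0 (wpow x M) k = anchored x b k.
Proof.
move=> x0 xb kM; rewrite nth_wpow // (@eq_anchored x b 0 k); first by rewrite -[k in RHS]add0n anchoredE.
by move/eqP: xb => ->; rewrite mod0n.
Qed.


(** A cyclic period that properly divides the length would make [x] a power of its prefix of length
    [g]. *)
Lemma primitive_period x g : primitive x -> 0 < g -> g %| size x ->
  (forall k, nth a0 x ((k + g) %% size x) = nth a0 x (k %% size x)) -> g = size x.
Proof.
move=> [x0 px] g0 gx h; apply/eqP/negPn/negP => ne.
have sx : 0 < size x by rewrite lt0n size_eq0.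
have gl : g < size x by rewrite ltn_neqAle ne dvdn_leq.
have per k j : nth a0 x ((k + j * g) %% size x) = nth a0 x (k %% size x).
  by elim: j => [|j IH]; rewrite ?addn0 // mulSn addnCA addnC h.
have := px (take g x) (size x %/ g); rewrite ltn_divRL // mul1n gl => /(_ isT)/eqP; apply.
apply: (@eq_from_nth _ a0); first by rewrite size_wpow size_takel ?divnK // ltnW.
move=> i ix; rewrite nth_wpow size_takel ?divnK //; try exact: ltnW.
rewrite nth_take ?ltn_mod // -[i in LHS](modn_small ix) [i in LHS](divn_eq i g) addnC per.
by rewrite modn_small // (ltn_trans _ gl) // ltn_mod.
Qed.

(** A window of [size x] positions meets every residue class, so what is known on one window
    transfers to all positions. *)
Lemma anchored_shift x b c j : 0 < size x ->
  exists2 k, k < size x & c + k = b + j %[mod size x].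
Proof.
move=> x0; exists ((b + j + c * (size x).-1) %% size x); first by rewrite ltn_mod.
rewrite modnDmr -(modn_shift c (b + j)) // addnA. by congr (_ %% _); lia.
Qed.

Lemma primitive_anchored_period x b c n g : primitive x -> 0 < g -> g %| size x ->
  size x + g <= n -> has_period (fun k => anchored x b (c + k)) g n -> g = size x.
Proof.
move=> px g0 gx len h.
have x0 : x != [::] by case: px.
have sx : 0 < size x by rewrite lt0n size_eq0.
apply: primitive_period => // j.
have [k kx e] := anchored_shift b c j sx.
have /= := h k ltac:(lia).
rewrite addnA (@anchored_modl _ _ (c + k) (b + j)) //.
rewrite (@anchored_modl _ _ (c + k + g) (b + (j + g))); last first.
  by rewrite addnA -modnDml e modnDml.
by rewrite !anchoredE.
Qed.

End Words.

Section Lyndon.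
Context (d : Order.disp_t) (A : orderType d) (a0 : A).
Implicit Types (x y u v w z : seq A).

Lemma lexle_anti x y : lexle x y -> lexle y x -> x = y.
Proof.
elim: x y => [|a x IH] [|b y] //= /orP[ab | /andP[/eqP <- xy]] /orP[].
- by move=> ba; have := Order.POrderTheory.lt_trans ab ba; rewrite Order.POrderTheory.ltxx.
- by case/andP=> /eqP e _; move: ab; rewrite e Order.POrderTheory.ltxx.
- by rewrite Order.POrderTheory.ltxx.
- by case/andP=> _ yx; rewrite (IH y).
Qed.

Lemma lyndon_neq0 x : lyndon x -> x != [::]. Proof. by case=> -[]. Qed.
Lemma lyndon_gt0 x : lyndon x -> 0 < size x.
Proof. by move/lyndon_neq0; rewrite -size_eq0 lt0n. Qed.

Lemma nth_rot s x i : s < size x -> i < size x ->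
  nth a0 (rot s x) i = nth a0 x ((s + i) %% size x).
Proof.
move=> sx ix; rewrite /rot nth_cat size_drop; case: ltnP => h.
  by rewrite nth_drop modn_small //; lia.
rewrite nth_take; last by lia.
have -> : s + i = (i - (size x - s)) + size x by lia.
by rewrite modnDr modn_small //; lia.
Qed.

(** On the common window both lengths are periods, hence so is their gcd, and primitivity forces the
    gcd to be both [size x] and [size y]. The two words are then conjugate, so equal because each is
    minimal in its class. *)
Lemma sync x y b b' c : lyndon x -> lyndon y ->
  (forall k, k < size x + size y -> anchored a0 x b (c + k) = anchored a0 y b' (c + k)) ->
  x = y /\ b = b' %[mod size x].
Proof.
move=> lx ly h.
have [x0 y0] := (lyndon_neq0 lx, lyndon_neq0 ly).
have [sx sy] := (lyndon_gt0 lx, lyndon_gt0 ly).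
pose H k := anchored a0 x b (c + k).
have px : has_period H (size x) (size x + size y).
  by move=> k _; rewrite /H addnA anchored_period.
have py : has_period H (size y) (size x + size y).
  by move=> k kl; rewrite /H !h; [rewrite addnA anchored_period | lia | lia].
have := fine_wilf sx sy (leqnn _) px py; set g := gcdn _ _ => pg.
have g0 : 0 < g by rewrite gcdn_gt0 sx.
have gy : g <= size y by apply: dvdn_leq => //; apply: dvdn_gcdr.
have gx : g <= size x by apply: dvdn_leq => //; apply: dvdn_gcdl.
have [gdx gdy] : g %| size x /\ g %| size y by rewrite dvdn_gcdl dvdn_gcdr.
clearbody g.
have ex : g = size x.
  apply: (@primitive_anchored_period _ a0 x b c (size x + size y)) => //; first by case: lx.
  by rewrite leq_add2l.
have ey : g = size y.
  apply: (@primitive_anchored_period _ a0 y b' c (size x + size y)) => //; first by case: ly.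
    by rewrite addnC leq_add2r.
  by move=> k kl; have := pg k kl; rewrite /H !h //; lia.
have e : size x = size y by rewrite -ex.
have hx j : anchored a0 x b j = anchored a0 y b' j.
  have [k kx ek] := anchored_shift 0 c j sx.
  have hk := h k (ltn_addr _ kx).
  rewrite add0n in ek.
  by rewrite -(anchored_modl _ _ ek) hk; apply: anchored_modl; rewrite -e.
have rotE x' y' p p' : lyndon x' -> lyndon y' -> size x' = size y' ->
   (forall j, anchored a0 x' p j = anchored a0 y' p' j) ->
   exists2 s, s < size x' & y' = rot s x'.
  move=> l1 l2 e' hj; have s1 := lyndon_gt0 l1.
  exists ((p' + p * (size x').-1) %% size x'); rewrite ?ltn_mod //.
  apply: (@eq_from_nth _ a0); first by rewrite size_rot.
  move=> i iy; rewrite nth_rot ?ltn_mod //; last by rewrite e'.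
  have := hj (p' + i); rewrite anchoredE ?lyndon_neq0 // modn_small // => <-.
  by rewrite /anchored; rewrite modnDml addnAC.
have [s sl es] := rotE _ _ _ _ lx ly e hx.
have [s' sl' es'] := rotE _ _ _ _ ly lx (esym e) (fun j => esym (hx j)).
have exy : x = y.
  apply: lexle_anti; first by rewrite es; apply: (proj2 lx).
  by rewrite es'; apply: (proj2 ly).
split => //; clear es es'; subst y.
(* [r] is the phase difference $b-b'$ modulo [size x]; if it were nonzero, it would be a period of
   the powers of [x] shorter than the primitive word [x]. *)
pose r := (b + b' * (size x).-1) %% size x.
have pr k : anchored a0 x 0 (k + r) = anchored a0 x 0 k.
  have := hx (b + k); rewrite anchoredE // => e1.
  by rewrite /anchored !mul0n !addn0 modnDmr e1 /anchored addnCA addnA.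
have [r0|r0] := posnP r.
  have : b + b' * (size x).-1 = b' + b' * (size x).-1 %[mod size x].
    by rewrite -/r r0 -{1}(addn0 b') modn_shift ?mod0n.
  by move/eqP; rewrite eqn_modDr => /eqP.
have rx : r < size x by rewrite ltn_mod.
clearbody r.
pose K k := anchored a0 x 0 (0 + k).
have k1 : has_period K (size x) (size x + size x) by move=> k _; rewrite /K addnA anchored_period.
have k2 : has_period K r (size x + size x) by move=> k _; rewrite /K !add0n pr.
have rx' : size x + r <= size x + size x by rewrite leq_add2l ltnW.
have := fine_wilf sx r0 rx' k1 k2; set g' := gcdn _ _ => pg'.
have g'r : g' <= r by apply: dvdn_leq => //; apply: dvdn_gcdr.
suff : g' = size x by move=> e'; rewrite e' leqNgt rx in g'r.
apply: (@primitive_anchored_period _ a0 x 0 0 (size x + size x)) => //; first by case: lx.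
- by rewrite gcdn_gt0 sx.
- exact: dvdn_gcdl.
- by rewrite leq_add2l (leq_trans g'r) // ltnW.
Qed.
End Lyndon.

(* [size] may occur at several convertible copies of the letter type, which [lia]
   takes for different atoms; hypotheses it cannot use are dropped for speed. *)
Ltac slia :=
  intros; repeat match goal with
  | H : context [modn] |- _ => clear H
  | H : forall _, _ |- _ => clear H
  end; try match goal with A : Order.Total.type _ |- _ =>
    change (@size ?T ?x) with (@size (Order.Total.sort A) x) in * end; lia.
Lemma modn_gap l m n : m = n %[mod l] -> m < n -> m + l <= n.
Proof.
move=> e lt; have : l %| n - m by rewrite -eqn_mod_dvd ?e // ltnW.
by move/dvdn_leq; rewrite subn_gt0 => /(_ lt); rewrite leq_subRL // ltnW.
Qed.

Lemma modn_addM l m k : m + k * l = m %[mod l].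
Proof. by rewrite addnC modnMDl. Qed.

(** * Occurrences of powers in x^M u y^M' *)

Section Host.
Context (d : Order.disp_t) (A : orderType d) (a0 : A).
Implicit Types (x y u v w z p r : seq A).

Lemma prefix_cat_size z s r : prefix z (s ++ r) -> size z <= size s -> prefix z s.
Proof. by rewrite !prefixE => /eqP e le; rewrite -{2}e takel_cat. Qed.

Lemma suffix_cat_size z s r : suffix z (r ++ s) -> size z <= size s -> suffix z s.
Proof.
rewrite !suffixE => /eqP e le; rewrite -{2}e size_cat drop_cat ltnNge.
have -> : size r <= size r + size s - size z by slia.
by rewrite /=; apply/eqP; congr drop; slia.
Qed.

Lemma read_prefix w x s : x != [::] -> s + size x <= size w ->
  (forall k, s <= k < s + size x -> nth a0 w k = anchored a0 x s k) ->
  prefix x (drop s w).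
Proof.
move=> x0 sw h; have xd : size x <= size (drop s w) by rewrite size_drop; slia.
rewrite prefixE; apply/eqP; apply: (@eq_from_nth _ a0); rewrite size_takel // => i ix.
rewrite nth_take // nth_drop h; last by slia.
by rewrite anchoredE // modn_small.
Qed.

Lemma read_suffix w x e : x != [::] -> size x <= e <= size w ->
  (forall k, e - size x <= k < e -> nth a0 w k = anchored a0 x e k) ->
  suffix x (take e w).
Proof.
move=> x0 /andP[xe ew] h; rewrite suffixE size_takel //.
have sd : size (drop (e - size x) (take e w)) = size x by rewrite size_drop size_takel //; slia.
apply/eqP; apply: (@eq_from_nth _ a0); rewrite sd // => i ix.
rewrite nth_drop nth_take; last by slia.
rewrite h; last by slia.
rewrite (@eq_anchored _ _ _ _ (e - size x)); last by rewrite -[e in LHS](subnK xe) modnDr.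
by rewrite anchoredE // modn_small //; slia.
Qed.

Lemma nth_infix_wpow z N p r k : z != [::] ->
  size p <= k < size p + N * size z ->
  nth a0 (p ++ wpow z N ++ r) k = anchored a0 z (size p) k.
Proof.
move=> z0 /andP[pk kp]; rewrite nth_cat ltnNge pk /= nth_cat size_wpow.
have -> : k - size p < N * size z by slia.
by rewrite nth_wpow; [rewrite -{2}(subnKC pk) anchoredE | slia].
Qed.

(** Recovers the initial word of a term from a long prefix. The two runs overlap enough to be in
    phase, so if [v] were shorter than [v'] the gap would hold a whole copy of [x], and [v'] would
    end with it. *)
Lemma prefix_power_inj x x' v v' N P : lyndon x -> lyndon x' ->
  ~~ suffix x v -> ~~ suffix x' v' -> size v + size v' + size x + size x' <= N ->
  prefix (v ++ wpow x N) P -> prefix (v' ++ wpow x' N) P -> v = v'.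
Proof.
wlog le : x x' v v' / size v <= size v'.
  move=> th lx lx' nx nx' len px px'; case: (leqP (size v) (size v')) => [h|/ltnW h].
    exact: th h lx lx' nx nx' len px px'.
  by apply/esym; apply: th h lx' lx nx' nx _ px' px; slia.
move=> lx lx' nx nx' len /prefixP[r]; rewrite -catA => eP /prefixP[r']; rewrite -catA => eP'.
have [[x0 x0'] [sx sx']] := ((lyndon_neq0 lx, lyndon_neq0 lx'), (lyndon_gt0 lx, lyndon_gt0 lx')).
have [N1 N2] : N <= N * size x /\ N <= N * size x' by rewrite !leq_pmulr.
have [|e1 e2] := @sync _ _ a0 x x' (size v) (size v') (size v') lx lx'.
  move=> k kl; rewrite -(@nth_infix_wpow x N v r) //; last by slia.
  by rewrite -eP eP' nth_infix_wpow //; slia.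
case: (ltngtP (size v) (size v')) => [lt|lt|eq].
- have gap := modn_gap e2 lt; move/negP: nx'; case; rewrite -e1.
  have -> : v' = take (size v') P by rewrite eP' take_size_cat.
  apply: read_suffix => //; first by rewrite eP' size_cat; slia.
  move=> k kl; rewrite eP nth_infix_wpow //; [exact: eq_anchored | slia].
- by slia.
- have : take (size v) P = take (size v') P by rewrite eq.
  by rewrite {1}eP eP' !take_size_cat.
Qed.

(** Mirror image, for final words. Positions are still counted from the left, so the common window
    starts where the later run begins and the ends of the runs are compared. *)
Lemma suffix_power_inj x x' v v' N P : lyndon x -> lyndon x' ->
  ~~ prefix x v -> ~~ prefix x' v' -> size v + size v' + size x + size x' <= N ->
  suffix (wpow x N ++ v) P -> suffix (wpow x' N ++ v') P -> v = v'.
Proof.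
wlog le : x x' v v' / size v <= size v'.
  move=> th lx lx' nx nx' len px px'; case: (leqP (size v) (size v')) => [h|/ltnW h].
    exact: th h lx lx' nx nx' len px px'.
  by apply/esym; apply: th h lx' lx nx' nx _ px' px; slia.
move=> lx lx' nx nx' len /suffixP[p eP] /suffixP[p' eP'].
have [[x0 x0'] [sx sx']] := ((lyndon_neq0 lx, lyndon_neq0 lx'), (lyndon_gt0 lx, lyndon_gt0 lx')).
have [N1 N2] : N <= N * size x /\ N <= N * size x' by rewrite !leq_pmulr.
have sP : size P = size p + N * size x + size v by rewrite eP !size_cat size_wpow addnA.
have sP' : size P = size p' + N * size x' + size v' by rewrite eP' !size_cat size_wpow addnA.
pose c := maxn (size p) (size p').
have [|e1 e2] := @sync _ _ a0 x x' (size p) (size p') c lx lx'.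
  move=> k kl; rewrite -(@nth_infix_wpow x N p v) //; last by slia.
  by rewrite -eP eP' nth_infix_wpow //; slia.
subst x'; have e : size p' + N * size x = size p + N * size x %[mod size x].
  by rewrite !modn_addM.
have dP : v = drop (size p + N * size x) P.
  by rewrite eP catA drop_size_cat // size_cat size_wpow.
have dP' : v' = drop (size p' + N * size x) P.
  by rewrite eP' catA drop_size_cat // size_cat size_wpow.
case: (ltngtP (size p' + N * size x) (size p + N * size x)) => [lt|lt|eq].
- have gap := modn_gap e lt; move/negP: nx'; case; rewrite dP'.
  apply: read_prefix => //; first by slia.
  move=> k kl; rewrite eP nth_infix_wpow //; last by slia.
  by apply: eq_anchored; rewrite modn_addM.
- by slia.
- by rewrite dP dP' eq.
Qed.

Section Occ.
Variables (x u y : seq A) (M M' : nat).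
Hypotheses (lx : lyndon x) (ly : lyndon y).
Let h := wpow x M ++ u ++ wpow y M'.
Let b := M * size x.
Let a := b + size u.

(** The guards on [M] and [M'] let one of the exponents vanish, so that the two ends of a term and
    pure powers are hosts as well. *)
Hypothesis npre : 0 < M -> ~~ prefix x (u ++ wpow y M').
Hypothesis nsuf : 0 < M' -> ~~ suffix y u.

Lemma host_size : size h = a + M' * size y.
Proof. by rewrite /h !size_cat !size_wpow addnA. Qed.

Lemma host_left k : k < b -> nth a0 h k = anchored a0 x b k.
Proof.
move=> kb; rewrite /h nth_cat size_wpow kb.
by rewrite (nth_wpow_anchored a0 (b := b)) ?lyndon_neq0 // dvdn_mull.
Qed.

Lemma host_right k : a <= k < a + M' * size y -> nth a0 h k = anchored a0 y a k.
Proof.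
move=> /andP[ak ka]; rewrite /h nth_cat size_wpow ltnNge.
rewrite (leq_trans (leq_addr _ _) ak) /= nth_cat ltnNge -/b.
have -> : size u <= k - b by rewrite /a in ak; slia.
rewrite /= -subnDA -/a nth_wpow; last by slia.
by rewrite -{2}(subnKC ak) anchoredE ?lyndon_neq0.
Qed.

Lemma occ_nth z N p r k : z != [::] -> h = p ++ wpow z N ++ r ->
  size p <= k < size p + N * size z -> nth a0 h k = anchored a0 z (size p) k.
Proof.
by move=> z0 ->; apply: nth_infix_wpow.
Qed.

(** If the power of [z] starts early enough to share [size z + size x] letters with the first run,
    it is in phase with it and cannot outlast it, by [npre]. Otherwise its length carries it across
    [u] and it shares [size z + size y] letters with the second run. *)
Lemma occ_power z N p r : lyndon z -> h = p ++ wpow z N ++ r ->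
  size u + size x + size y + 2 * size z <= N * size z ->
  (z = x /\ size p = b %[mod size x] /\ size p + N * size z <= b) \/
  (z = y /\ size p = a %[mod size y] /\ a < size p + N * size z).
Proof.
move=> lz eh len.
have [[z0 x0] y0] := (lyndon_neq0 lz, lyndon_neq0 lx, lyndon_neq0 ly).
have [[sz sx] sy] := (lyndon_gt0 lz, lyndon_gt0 lx, lyndon_gt0 ly).
have on := occ_nth z0 eh.
have hs : size p + N * size z <= a + M' * size y.
  by rewrite -host_size eh !size_cat size_wpow; slia.
have [left|nleft] := leqP (size p + size z + size x) b.
  left; have [|e1 e2] := @sync _ _ a0 z x (size p) b (size p) lz lx.
    by move=> k kl; rewrite -host_left ?on //; slia.
  subst z; split=> //; split => //; rewrite leqNgt; apply/negP => lt.
  have pb : size p <= b by slia.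
  have gap : b + size x <= size p + N * size x.
    by apply: modn_gap => //; rewrite modn_addM.
  have M0 : 0 < M by rewrite lt0n; apply/eqP => M0; rewrite /b M0 in left; slia.
  have /negP := npre M0; apply.
  have -> : u ++ wpow y M' = drop b h by rewrite /h drop_size_cat // size_wpow.
  apply: read_prefix => //; first by rewrite host_size; slia.
  by move=> k kl; rewrite on; [apply: eq_anchored | slia].
right; pose c := maxn a (size p).
have cl : c + size z + size y <= size p + N * size z by rewrite /c /a; slia.
have [|e1 e2] := @sync _ _ a0 z y (size p) a c lz ly.
  by move=> k kl; rewrite -host_right ?on //; slia.
subst z; split=> //; split=> //; slia.
Qed.

(** The first power cannot be continued in phase beyond its end, so it must end exactly where the
    run of [x] does. The second power is then in phase with the run of [y], and a difference between
    the lengths of [v] and [u] would give the longer one the suffix [y]. *)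
Lemma occ_transition z v z' N p r : lyndon z -> lyndon z' ->
  h = p ++ (wpow z N ++ v ++ wpow z' N) ++ r ->
  size u + size x + size y + 2 * size z <= N * size z ->
  size u + size x + size y + 2 * size z' <= N * size z' ->
  size z <= N -> ~~ prefix z (v ++ wpow z' N) -> ~~ suffix z' v ->
  [/\ z = x, z' = y, v = u & size p + N * size z = b].
Proof.
move=> lz lz' eh len len' zN nprez nsufz.
have [[[z0 x0] y0] z'0] := (lyndon_neq0 lz, lyndon_neq0 lx, lyndon_neq0 ly, lyndon_neq0 lz').
have [[[sz sx] sy] sz'] := (lyndon_gt0 lz, lyndon_gt0 lx, lyndon_gt0 ly, lyndon_gt0 lz').
have eh1 : h = p ++ wpow z N ++ (v ++ wpow z' N ++ r) by rewrite eh -!catA.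
have eh2 : h = (p ++ wpow z N ++ v) ++ wpow z' N ++ r by rewrite eh -!catA.
have on1 := occ_nth z0 eh1; have on2 := occ_nth z'0 eh2.
have zN' : size z <= N * size z' by rewrite (leq_trans zN) // leq_pmulr.
have hs : size h = size p + N * size z + size v + N * size z' + size r.
  by rewrite eh !size_cat !size_wpow; slia.
have hs' := host_size.
(* Continuing the power of [z] for one more copy would make [z] a prefix of [v ++ wpow z' N]. *)
have next : (forall k, size p + N * size z <= k < size p + N * size z + size z ->
    nth a0 h k = anchored a0 z (size p + N * size z) k) -> False.
  move=> rd; move/negP: nprez; apply.
  have dr : drop (size p + N * size z) h = (v ++ wpow z' N) ++ r.
    by rewrite eh1 catA drop_size_cat ?size_cat ?size_wpow // catA.
  apply: (@prefix_cat_size z (v ++ wpow z' N) r).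
    by rewrite -dr; apply: read_prefix => //; slia.
  by rewrite size_cat size_wpow; slia.
case: (occ_power lz eh1 len) => [[e1 [e2 e3]]|[e1 [e2 e3]]]; last first.
  subst z; case: next => k kl; rewrite host_right; last by slia.
  by apply: eq_anchored; rewrite modn_addM.
subst z; have eb : size p + N * size x = b.
  apply/eqP; rewrite eqn_leq e3 leqNgt; apply/negP => lt; apply: next => k kl.
  have gap : size p + N * size x + size x <= b by apply: modn_gap => //; rewrite modn_addM.
  by rewrite host_left; [apply: eq_anchored; rewrite modn_addM | slia].
have sp : size (p ++ wpow x N ++ v) = b + size v by rewrite !size_cat size_wpow -eb; slia.
rewrite sp in on2.
case: (occ_power lz' eh2 len') => [[_ [_]]|]; rewrite sp.
  rewrite -addnA -[X in _ <= X]addn0 leq_add2l leqn0 addn_eq0 => /andP[_].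
  by have := lyndon_gt0 lz'; move: len'; slia.
case=> e1 [e4 e5]; subst z'.
have M'0 : 0 < M' by rewrite lt0n; apply/eqP => M0; rewrite M0 in hs'; slia.
case: (ltngtP (size v) (size u)) => [lt|lt|eq].
- have gap : b + size v + size y <= a by apply: modn_gap => //; rewrite /a ltn_add2l.
  have /negP := nsuf M'0; case; apply: (@suffix_cat_size y u (wpow x M)); last by rewrite /a in gap; slia.
  have -> : wpow x M ++ u = take a h by rewrite /h catA take_size_cat // size_cat size_wpow.
  apply: read_suffix => //; first by rewrite host_size; slia.
  by move=> k kl; rewrite on2; [apply: eq_anchored | slia].
- have gap : a + size y <= b + size v by apply: modn_gap => //; rewrite /a ltn_add2l.
  move/negP: nsufz; case; apply: (@suffix_cat_size y v (p ++ wpow x N)); last by rewrite /a in gap; slia.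
  have -> : (p ++ wpow x N) ++ v = take (b + size v) h.
    by rewrite eh2 take_size_cat // -catA.
  apply: read_suffix => //; first by slia.
  by move=> k kl; rewrite host_right; [apply: eq_anchored | slia].
- split => //.
  have /eqP : wpow x M ++ u ++ wpow y M' = (p ++ wpow x N) ++ v ++ wpow y N ++ r.
    by rewrite -/h eh1 catA.
  rewrite eqseq_cat ?size_cat ?size_wpow // => /andP[_].
  by rewrite eqseq_cat // => /andP[/eqP].
Qed.
End Occ.
End Host.

Lemma oprodA (T : Type) (op : T -> T -> T) : associative op -> associative (oprod op).
Proof. by move=> opA [a|] [b|] [c|] //=; rewrite opA. Qed.
Lemma oprods0 (T : Type) (op : T -> T -> T) a : oprod op a None = a.
Proof. by case: a. Qed.

(** * The semigroup of normal forms *)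

Section Model.
Context (d : Order.disp_t) (A : orderType d) (gT : finGroupType).
Variables (inL : pred (seq A)) (f : seq A -> gT) (Ls : seq (seq A)).
Implicit Types (v w s p : seq A).
Hypothesis inL0 : inL [::] = false.
Hypothesis inL_infix : forall v w, inL w -> infix v w -> v != [::] -> inL v.
Hypothesis inL_Ls : forall w, inL w -> w \in Ls.
Hypothesis f0 : f [::] = 1%g.

Definition inL1 w := (w == [::]) || inL w.

Lemma inL1_infix v w : inL1 w -> infix v w -> inL1 v.
Proof.
rewrite /inL1 => /orP[/eqP->|wL vw]; first by rewrite infixs0 => ->.
by case: eqP => //= /eqP v0; apply: inL_infix vw v0.
Qed.
Lemma inL1_rconsl w a : inL1 (rcons w a) -> inL1 w.
Proof. by move/inL1_infix; apply; apply: infix_rcons. Qed.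
Lemma inL1_rcons w a : inL1 (rcons w a) = inL (rcons w a).
Proof. by rewrite /inL1 -size_eq0 size_rcons. Qed.

Fixpoint lsuf w := if inL w then w else if w is _ :: w' then lsuf w' else [::].

Lemma lsuf_inL1 w : inL1 (lsuf w).
Proof. by elim: w => [|a w IH] /=; case: ifP => // h; rewrite /inL1 h orbT. Qed.
Lemma lsuf_suffix w : suffix (lsuf w) w.
Proof.
elim: w => [|a w IH] /=; case: ifP => // _; rewrite ?suffix_refl //.
by rewrite -cat1s suffix_catr.
Qed.
Lemma suffix_consE v a w : suffix v (a :: w) -> v = a :: w \/ suffix v w.
Proof.
case/suffixP=> -[|b s] /=; first by left.
by case=> _ ->; right; apply: suffix_suffix.
Qed.
Lemma lsuf_max v w : inL1 v -> suffix v w -> suffix v (lsuf w).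
Proof.
elim: w => [|a w IH] vL /=; first by rewrite suffixs0 => /eqP ->; rewrite suffix0s.
case: ifP => [//|aw] /suffix_consE[e|]; last exact: IH.
by move: vL; rewrite e /inL1 aw.
Qed.
Lemma suffix_anti v w : suffix v w -> suffix w v -> v = w.
Proof.
move=> vw wv; have e : size v = size w by apply/eqP; rewrite eqn_leq !size_suffix.
by move: vw; rewrite suffixE e subnn drop0 => /eqP.
Qed.
Lemma lsuf_id w : inL1 w -> lsuf w = w.
Proof.
move=> wL; apply: suffix_anti; first exact: lsuf_suffix.
by apply: lsuf_max => //; apply: suffix_refl.
Qed.
Lemma suffix_rconsE v w a : suffix v (rcons w a) ->
  v = [::] \/ exists2 v', v = rcons v' a & suffix v' w.
Proof.
case: (lastP v) => [|v' b]; first by left.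
rewrite suffix_rcons => /andP[/eqP -> h]; right; exists v' => //.
Qed.
(** Removing the last letter from a suffix in L leaves a suffix in L or the empty word. Hence an
    automaton that remembers only the longest suffix in L can update it. *)
Lemma lsuf_rcons s w a : suffix (lsuf w) s -> suffix s w ->
  lsuf (rcons s a) = lsuf (rcons w a).
Proof.
move=> ws sw; apply: suffix_anti; apply: lsuf_max (lsuf_inL1 _) _.
  by apply: suffix_trans (lsuf_suffix _) _; rewrite suffix_rcons eqxx.
case: (suffix_rconsE (lsuf_suffix (rcons w a))) => [->|[v e vw]].
  exact: suffix0s.
rewrite e suffix_rcons eqxx /=; apply: suffix_trans ws.
apply: lsuf_max => //; apply: (@inL1_rconsl _ a).
by rewrite -e lsuf_inL1.
Qed.

(* normal forms: (None, s) stands for the word s, (Some (p, k), s) for p k s *)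
Definition state := (option (seq A * gT) * seq A)%type.
Implicit Types (st : state) (o : option (seq A * gT)).

(** A word can be replaced by its value under [f] only between group elements. So the first word
    pushed is kept as left end, and only later ones are multiplied into the middle. *)
Definition push o s (k : gT) : option (seq A * gT) :=
  Some (if o is Some pg then (pg.1, (pg.2 * f s * k)%g) else (s, k)).
(** The element pushed at a letter leaving L is 1 because it stands for [f] of a minimal word
    outside L, on which [f] is going to be trivial. *)
Definition step st (z : A + gT) : state :=
  match z with
  | inl a => let w := rcons st.2 a in
             if inL w then (st.1, w) else (push st.1 st.2 1, lsuf w)
  | inr k => (push st.1 st.2 k, [::])
  end.
Definition run st z := foldl step st z.
Definition code st : seq (A + gT) :=
  if st.1 is Some pg then map inl pg.1 ++ inr pg.2 :: map inl st.2 else map inl st.2.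
Definition valid st :=
  inL1 st.2 && (if st.1 is Some pg then inL1 pg.1 else true).

Lemma run_cat st z1 z2 : run st (z1 ++ z2) = run (run st z1) z2.
Proof. exact: foldl_cat. Qed.
Lemma run_rcons st z c : run st (rcons z c) = step (run st z) c.
Proof. by rewrite -cats1 run_cat. Qed.

Lemma run_word o s : inL1 s -> run (o, [::]) (map inl s) = (o, s).
Proof.
elim/last_ind: s => [|s a IH] // sL.
rewrite map_rcons run_rcons IH ?(inL1_rconsl sL) //=.
by rewrite -inL1_rcons sL.
Qed.

Lemma run_code st : valid st -> run (None, [::]) (code st) = st.
Proof.
case: st => -[[p g]|] s /andP[/= sL pL]; rewrite /code /=; last by rewrite run_word.
by rewrite run_cat run_word //= run_word.
Qed.

Lemma step_suffix2 st a : (step st (inl a)).2 = lsuf (rcons st.2 a).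
Proof. by rewrite /=; case: ifP => // h; rewrite lsuf_id // inL1_rcons. Qed.

Lemma step_valid st z : valid st -> valid (step st z).
Proof.
case: z => [a|k] /andP[sL oL]; rewrite /valid.
  rewrite step_suffix2 lsuf_inL1 /=; case: ifP => //= _.
  by rewrite /push; case: st.1 oL.
by rewrite /= /push; case: st.1 oL.
Qed.
Lemma run_valid st z : valid st -> valid (run st z).
Proof. by elim: z st => //= c z IH st /step_valid h; apply: IH. Qed.

Lemma run_suffix st s : inL1 s -> suffix s (run st (map inl s)).2.
Proof.
elim/last_ind: s => [|s a IH] sL; first exact: suffix0s.
rewrite map_rcons run_rcons step_suffix2; apply: lsuf_max => //.
by rewrite suffix_rcons eqxx IH // (inL1_rconsl sL).
Qed.

Lemma push_push o t g s k : push (push o t g) s k = push o t (g * f s * k)%g.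
Proof. by case: o => [[p h]|]; rewrite /push //= !mulgA. Qed.

(** The core of associativity. The delicate case is a bare word [s] that overflows: after [st] the
    current word [s1] has [s] as a suffix, so it overflows too, and the new longest suffix is the
    same for both since it must be shorter than [rcons s a]. *)
Lemma run_code_step st st' z : valid st' ->
  run st (code (step st' z)) = step (run st (code st')) z.
Proof.
case: st' => -[[p g]|] s /andP[/= sL pL]; case: z => [a|k] /=.
- rewrite {2}/code /= run_cat /= run_word //=.
  case: ifP => h; first by rewrite /code /= run_cat /= run_word ?inL1_rcons.
  by rewrite /code /= run_cat /= run_word ?lsuf_inL1 // push_push.
- by rewrite /code /= !run_cat /= run_word //= push_push.
- case: ifP => h; first by rewrite /code /= map_rcons run_rcons.
  rewrite /code /= run_cat /=.
  have := run_suffix st sL; case E: (run st _) => [o s1] /= ss.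
  rewrite run_word ?lsuf_inL1 //.
  have -> : inL (rcons s1 a) = false.
    apply/negP => /inL_infix H; move: h; rewrite H //.
      by apply: suffixW; rewrite suffix_rcons eqxx.
    by rewrite -size_eq0 size_rcons.
  congr (_, _).
  apply: suffix_anti; apply: lsuf_max (lsuf_inL1 _) _.
    by apply: suffix_trans (lsuf_suffix _) _; rewrite suffix_rcons eqxx.
  have lw := lsuf_suffix (rcons s1 a).
  have le : size (lsuf (rcons s1 a)) <= size (rcons s a).
    rewrite leqNgt; apply/negP => lt; move: h.
    have : suffix (rcons s a) (lsuf (rcons s1 a)).
      have : suffix (rcons s a) (rcons s1 a) by rewrite suffix_rcons eqxx.
      case/suffixP: lw => t e; rewrite {1}e => /suffix_cat_size; apply; exact: ltnW.
    move/suffixW/(inL1_infix (lsuf_inL1 _)); rewrite inL1_rcons => -> //.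
  case/suffixP: ss => t e; rewrite e rcons_cat in lw le *.
  exact: suffix_cat_size lw le.
- by rewrite /code /= run_cat.
Qed.

Lemma run_code_run st st' z : valid st' ->
  run st (code (run st' z)) = run (run st (code st')) z.
Proof.
elim: z st' => //= c z IH st' v'.
by rewrite IH ?step_valid // run_code_step.
Qed.

Definition rop st st' := run st (code st').

Lemma rop_valid st st' : valid st -> valid (rop st st').
Proof. exact: run_valid. Qed.

Definition triv : state := (None, [::]).

Lemma step_triv st c : step st c != triv.
Proof.
apply/eqP; rewrite /triv; case: c => [a|k] //=; case: ifP => // _ [] _.
by move/(congr1 size); rewrite size_rcons.
Qed.
Lemma run_triv st z : z != [::] -> run st z != triv.
Proof.
case: (lastP z) => // {}z c _; by rewrite run_rcons step_triv.
Qed.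
Lemma code_neq0 st : st != triv -> code st != [::].
Proof.
by case: st => -[[[|a p] g]|] [|b s].
Qed.

(** The state of the empty word is left out: the presented object is a semigroup, without empty
    product. *)
Definition tvalid st := valid st && (st != triv).
Definition states : seq state :=
  [seq st <- [seq (o, s) | o <- None :: [seq Some (p, g) | p <- [::] :: Ls, g <- enum gT],
                           s <- [::] :: Ls] | tvalid st].

Lemma inL1_Ls w : inL1 w -> w \in [::] :: Ls.
Proof. by rewrite inE /inL1 => /orP[->//|/inL_Ls->]; rewrite orbT. Qed.

Lemma mem_states st : (st \in states) = tvalid st.
Proof.
rewrite mem_filter andb_idr //; case: st => o s /andP[/andP[sL oL] _].
apply/allpairsP; exists (o, s); split=> //; last exact: inL1_Ls.
move: oL; clear sL; case: o => [[p g]|] oL; rewrite inE ?eqxx //.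
by apply/orP; right; apply/allpairsP; exists (p, g); rewrite mem_enum inL1_Ls.
Qed.

Definition model := seq_sub states.

Lemma model_valid (t : model) : tvalid (val t).
Proof. by rewrite -mem_states; apply: ssvalP. Qed.

(** The default [t] is never taken, as [val_model_op] shows. *)
Definition model_op (t t' : model) : model := insubd t (rop (val t) (val t')).

Lemma group_state_mem (k : gT) : (Some ([::], k), [::]) \in states.
Proof. by rewrite mem_states. Qed.
Definition model_G (k : gT) : model := SeqSub (group_state_mem k).
Definition model_A (a : A) : model := insubd (model_G 1) (None, [:: a]).

Lemma val_model_op t t' : val (model_op t t') = rop (val t) (val t').
Proof.
rewrite /model_op insubdK // -topredE /= mem_states /tvalid.
have [v n] := andP (model_valid t); have [v' n'] := andP (model_valid t').
by rewrite rop_valid // run_triv // code_neq0.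
Qed.
Lemma val_model_A a : inL [:: a] -> val (model_A a) = (None, [:: a]).
Proof.
by move=> aL; rewrite /model_A insubdK // -topredE /= mem_states /tvalid /valid /inL1 aL.
Qed.

Lemma model_opA : associative model_op.
Proof.
move=> t1 t2 t3; apply: val_inj; rewrite !val_model_op.
by rewrite /rop run_code_run //; case/andP: (model_valid t2).
Qed.

(** * Evaluating normal forms in any semigroup with the relations *)

Section Eval.
Variables (T : Type) (op : T -> T -> T) (iA : A -> T) (iG : gT -> T).
Definition gen (z : A + gT) := match z with inl a => iA a | inr h => iG h end.
Definition gev z := foldr (fun z acc => oprod op (Some (gen z)) acc) None z.

Hypothesis opA : associative op.
Lemma gev_cons c z : gev (c :: z) = oprod op (Some (gen c)) (gev z).
Proof. by []. Qed.
Lemma gev_cat z1 z2 : gev (z1 ++ z2) = oprod op (gev z1) (gev z2).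
Proof. by elim: z1 => // c z1 IH; rewrite cat_cons !gev_cons IH (oprodA opA). Qed.
Lemma gev_word w : gev (map inl w) = wprod op iA w.
Proof. by elim: w => //= a w ->. Qed.
Lemma gev_neq0 z : z != [::] -> exists t, gev z = Some t.
Proof. by case: z => // c z _; rewrite gev_cons; case: (gev z) => [t|]; eexists. Qed.
End Eval.

Definition good_letters (z : seq (A + gT)) :=
  all (fun c => if c is inl a then inL [:: a] else true) z.

Lemma gev_model z : good_letters z -> z != [::] ->
  exists2 t, gev model_op model_A model_G z = Some t & val t = run triv z.
Proof.
elim: z => //= c z IH /andP[cL zL] _.
have vc : val (gen model_A model_G c) = step triv c.
  by case: c cL => [a|k] aL //=; rewrite val_model_A // aL.
case: z IH zL => [|c' z] IH zL; first by exists (gen model_A model_G c).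
have [t -> vt] := IH zL isT; exists (model_op (gen model_A model_G c) t) => //.
by rewrite val_model_op (_ : val t = run triv (c' :: z)) // vc /rop run_code_run.
Qed.

Section Relations.
Variables (T : Type) (op : T -> T -> T) (iA : A -> T) (iG : gT -> T).
Hypothesis opA : associative op.
Definition forbidden v :=
  [&& 1 < size v, ~~ inL v, inL (take (size v).-1 v) & inL (behead v)].
Definition relations :=
  [/\ (forall a b : gT, op (iG a) (iG b) = iG (a * b)%g),
      (forall w, inL w ->
         oprod op (oprod op (Some (iG 1%g)) (wprod op iA w)) (Some (iG 1%g))
         = Some (iG (f w))) &
      (forall v, forbidden v ->
         wprod op iA v =
         oprod op (oprod op (wprod op iA (take (size v).-1 v)) (Some (iG (f v))))
                  (wprod op iA (behead v)))].
Hypothesis rel : relations.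
Local Notation ev := (gev op iA iG).
Local Notation "a ** b" := (oprod op a b) (at level 40, left associativity).


Lemma ev_group k l : ev [:: inr k; inr l] = ev [:: inr (k * l)%g].
Proof. by case: rel => h _ _ /=; rewrite h. Qed.

Lemma ev_sandwich w : inL1 w ->
  ev (inr 1%g :: map inl w ++ [:: inr 1%g]) = ev [:: inr (f w)].
Proof.
rewrite /inL1 => /orP[/eqP->|wL].
  by rewrite f0; have := ev_group 1 1; rewrite mulg1 => <-.
case: rel => _ h _; have := h w wL => {}h.
by rewrite -cat1s catA !gev_cat // gev_word h.
Qed.

Lemma ev_eq_ctx l r z1 z2 : ev z1 = ev z2 -> ev (l ++ z1 ++ r) = ev (l ++ z2 ++ r).
Proof. by move=> e; rewrite gev_cat // (gev_cat _ _ _ z1) // e -!gev_cat. Qed.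

Lemma ev_sandwich2 w k l : inL1 w ->
  ev (inr k :: map inl w ++ [:: inr l]) = ev [:: inr (k * f w * l)%g].
Proof.
move=> wL.
transitivity (ev ([:: inr k] ++ (inr 1%g :: map inl w ++ [:: inr 1%g]) ++ [:: inr l])).
  have -> : [:: inr k] ++ (inr 1%g :: map inl w ++ [:: inr 1%g]) ++ [:: inr l] =
            [:: inr k; inr 1%g] ++ map inl w ++ [:: inr 1%g; inr l] :> seq (A + gT).
    by rewrite /= -catA.
  by rewrite !gev_cat // !ev_group mulg1 mul1g -!gev_cat.
have gM k' l' : oprod op (ev [:: inr k']) (ev [:: inr l']) = ev [:: inr (k' * l')%g].
  by rewrite -gev_cat // ev_group.
by rewrite !gev_cat // ev_sandwich // !gM mulgA.
Qed.

Lemma ev_forbidden v l r : forbidden v ->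
  ev (l ++ map inl v ++ r) =
  ev (l ++ map inl (take (size v).-1 v) ++ inr (f v) :: map inl (behead v) ++ r).
Proof.
case: rel => _ _ h vF.
have hv : ev (map inl v) =
          ev (map inl (take (size v).-1 v) ++ inr (f v) :: map inl (behead v)).
  by rewrite gev_cat // gev_cons !gev_word h // (oprodA opA).
by rewrite gev_cat // (gev_cat _ _ _ (map inl v)) // hv -!gev_cat // -!catA.
Qed.
Hypothesis f_forbidden : forall v, forbidden v -> f v = 1%g.

(** Extend [lsuf (rcons s a)] by the letter [b] before it: this is a minimal word [v] outside L, and
    its relation splits [rcons s a] into [s] and the longest suffix, with [f v = 1] in between. *)
Lemma ev_overflow s a : inL1 s -> inL [:: a] -> inL (rcons s a) = false ->
  ev (map inl (rcons s a)) = ev (map inl s ++ inr 1%g :: map inl (lsuf (rcons s a))).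
Proof.
move=> sL aL nL.
have sfa : suffix [:: a] (lsuf (rcons s a)).
  by apply: lsuf_max; rewrite /inL1 ?aL // -cats1 suffix_suffix.
have : lsuf (rcons s a) != rcons s a.
  by apply: contraFneq nL => <-; have := lsuf_inL1 (rcons s a); rewrite /inL1;
     case: (lsuf _) sfa => //.
case/suffixP: (lsuf_suffix (rcons s a)); case/lastP => [|l b].
  by move=> /= <-; rewrite eqxx.
case/suffixP: sfa => S0 eS; rewrite eS -{1}cats1 => e _.
have es : s = l ++ b :: S0.
  by move: e; rewrite catA cats1 -{1}cats1 !cats1 => /rcons_inj[->]; rewrite cat_rcons.
pose v := b :: rcons S0 a.
have vF : forbidden v.
  rewrite /forbidden /= size_rcons /=; apply/and3P; split.
  - apply/negP => vL; have : suffix v (lsuf (rcons s a)).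
      apply: lsuf_max; first by rewrite /inL1 vL orbT.
      by rewrite es -cats1 -catA /= cats1 suffix_suffix.
    by move/size_suffix; rewrite eS cats1 /v /= ltnn.
  - have sLL : inL s by case/orP: sL => // /eqP s0; move: es; rewrite s0; case: (l).
    apply: inL_infix sLL _ _ => //.
    by rewrite es -cats1 take_size_cat // suffixW // suffix_suffix.
  - by have := lsuf_inL1 (rcons s a); rewrite eS cats1 inL1_rcons.
have := ev_forbidden (map inl l) [::] vF; rewrite f_forbidden // !cats0.
have -> : take (size v).-1 v = b :: S0 by rewrite /v /= size_rcons /= -cats1 take_size_cat.
rewrite [behead _]/= => e'.
have -> : rcons s a = l ++ v by rewrite es /v -cats1 -catA /= cats1.
by rewrite map_cat e' catA -map_cat es cats1.
Qed.

Lemma ev_step st z : valid st -> good_letters [:: z] ->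
  ev (code (step st z)) = ev (code st ++ [:: z]).
Proof.
case: st => o s /andP[/= sL oL]; rewrite andbT; case: z => [a|k] /=.
- case: ifP => h aL.
    by case: o oL => [[p g]|] oL; rewrite /code /= map_rcons -cats1 // -catA.
  case: o oL => [[p g]|] oL; rewrite /code /=; last first.
    by rewrite -ev_overflow // map_rcons cats1.
  have := ev_overflow sL aL h => /(ev_eq_ctx (map inl p ++ [:: inr g]) [::]).
  rewrite !cats0 map_rcons -cats1 -!catA /= => ->.
  have := ev_sandwich2 g 1 sL => /(ev_eq_ctx (map inl p) (map inl (lsuf (rcons s a)))).
  by rewrite /= -catA /= => ->.
- case: o oL => [[p g]|] oL; rewrite /code //=.
  move=> _; have := ev_sandwich2 g k sL => /(ev_eq_ctx (map inl p) [::]).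
  by rewrite -catA !cats0 => <-.
Qed.

Lemma ev_run st z : valid st -> good_letters z -> ev (code (run st z)) = ev (code st ++ z).
Proof.
elim: z st => [|c z IH] st vst /=; first by rewrite cats0.
case/andP=> cL zL; rewrite IH ?step_valid // gev_cat // ev_step //=; last by rewrite cL.
by rewrite -gev_cat // -catA.
Qed.
End Relations.

Lemma inL1_letters w : inL1 w -> good_letters (map inl w).
Proof.
move=> wL; rewrite /good_letters all_map; apply/allP => a aw /=.
have : inL1 [:: a] by apply: inL1_infix wL _; rewrite infix1s.
by [].
Qed.

Lemma code_letters st : valid st -> good_letters (code st).
Proof.
case: st => -[[p g]|] s /andP[sL oL]; rewrite /code /= ?inL1_letters //.
by rewrite /good_letters all_cat /= -!/(good_letters _) !inL1_letters.
Qed.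

Lemma model_gev t : gev model_op model_A model_G (code (val t)) = Some t.
Proof.
have /andP[vt nt] := model_valid t.
have [t' -> e] := gev_model (code_letters vt) (code_neq0 nt).
by congr Some; apply: val_inj; rewrite e run_code.
Qed.

Lemma model_universal (T' : Type) (op' : T' -> T' -> T') (iA' : A -> T') (iG' : gT -> T') :
  associative op' -> relations op' iA' iG' -> (forall v, forbidden v -> f v = 1%g) ->
  exists h : model -> T',
    [/\ forall a b, h (model_op a b) = op' (h a) (h b),
        forall a, inL [:: a] -> h (model_A a) = iA' a &
        forall z, h (model_G z) = iG' z].
Proof.
move=> opA rel ff; pose ev := gev op' iA' iG'.
(* The default is never reached, because elements of the model have a non-empty code. *)
pose h (t : model) := odflt (iG' 1%g) (ev (code (val t))).
have hE t : ev (code (val t)) = Some (h t).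
  have /andP[vt nt] := model_valid t; rewrite /h.
  by have [t' e] := gev_neq0 op' iA' iG' (code_neq0 nt); rewrite /ev e.
exists h; split.
- move=> a b; apply: Some_inj; rewrite -hE val_model_op /ev ev_run //.
  + by rewrite gev_cat // -!/(ev _) !hE.
  + by have /andP[] := model_valid a.
  + by have /andP[/code_letters] := model_valid b.
- by move=> a aL; apply: Some_inj; rewrite -hE val_model_A.
- by move=> k; apply: Some_inj; rewrite -hE /ev /code /= ; case: rel => r _ _; rewrite /=.
Qed.

Lemma model_relations : (forall v, forbidden v -> f v = 1%g) ->
  relations model_op model_A model_G.
Proof.
move=> ff; split.
- move=> a b; apply: val_inj; rewrite val_model_op /rop /code /=.
  by rewrite /push /= f0 mulg1.
- move=> w wL; have wL1 : inL1 w by rewrite /inL1 wL orbT.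
  rewrite -(gev_word _ _ model_G) -[Some (model_G 1)]/(gev model_op model_A model_G [:: inr 1%g]).
  rewrite -!gev_cat; try exact: model_opA.
  have [||t -> e] := @gev_model (([:: inr 1%g] ++ map inl w) ++ [:: inr 1%g]) => //.
    by rewrite /good_letters !all_cat /= -/(good_letters _) inL1_letters.
  congr Some; apply: val_inj; rewrite e /= run_cat /= /push /= run_word //=.
  by rewrite mul1g mulg1.
- move=> v vF; rewrite ff //; case/lastP: v vF => [//|v0 a]; rewrite /forbidden.
  have -> : take (size (rcons v0 a)).-1 (rcons v0 a) = v0.
    by rewrite size_rcons -cats1 take_size_cat.
  case: v0 => [|b v1]; first by rewrite inL0 andbF.
  rewrite rcons_cons [behead _]/= => /and4P[_ nL aL bL].
  rewrite -!(gev_word _ _ model_G) -[Some (model_G 1)]/(gev model_op model_A model_G [:: inr 1%g]).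
  rewrite -!gev_cat; try exact: model_opA.
  have [aL1 bL1] : inL1 (b :: v1) /\ inL1 (rcons v1 a) by rewrite /inL1 aL bL !orbT.
  have [||t -> e] := @gev_model (map inl (b :: rcons v1 a)) => //.
    by rewrite /= /good_letters /= -/(good_letters _) inL1_letters //; case/andP: (inL1_letters aL1) => ->.
  have [||t' -> e'] := @gev_model ((map inl (b :: v1) ++ [:: inr 1%g]) ++ map inl (rcons v1 a)) => //.
    by rewrite /good_letters !all_cat -!/(good_letters _) !inL1_letters.
  congr Some; apply: val_inj; rewrite e e'.
  have -> : map inl (b :: rcons v1 a) = rcons (map inl (b :: v1)) (inl a) :> seq (A + gT).
    by rewrite -map_rcons.
  rewrite run_rcons !run_cat run_word //.
  rewrite [step _ _]/= (negbTE nL) [run _ [:: _]]/=.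
  by rewrite run_word // lsuf_id.
Qed.
End Model.

(** * The presented semigroup is a local group *)

Section LocalGroup.
Context (d : Order.disp_t) (A : orderType d) (gT : finGroupType).
Variables (inL : pred (seq A)) (f : seq A -> gT) (B : nat).
Implicit Types (v w : seq A).
Hypothesis size_inL : forall w, inL w -> size w <= B.

(** Dropping an end letter as long as the rest stays outside L leads to a minimal factor outside L;
    it has at least two letters because single letters are in L. *)
Lemma forbidden_infix w : w != [::] -> all (fun a => inL [:: a]) w -> ~~ inL w ->
  exists2 v, forbidden inL v & infix v w.
Proof.
have [n] := ubnP (size w); elim: n w => // n IH w sw w0 aw nw.
have ws : 1 < size w.
  by case: w w0 aw nw {sw} => [|a [|]] //= _; rewrite andbT => ->.
have hb : behead w != [::] by rewrite -size_eq0 size_behead -lt0n; slia.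
have ht : take (size w).-1 w != [::] by rewrite -size_eq0 size_take; case: ifP; slia.
have ib : infix (behead w) w by rewrite -drop1 infix_drop.
have it := infix_take w (size w).-1.
have sub v : infix v w -> all (fun a => inL [:: a]) v.
  by move=> /mem_infix vw; apply/allP => a /vw; apply: (allP aw).
have [bL|nb] := boolP (inL (behead w)); last first.
  have [|v vF vi] := IH (behead w) _ hb (sub _ ib) nb; first by rewrite size_behead; slia.
  by exists v => //; apply: infix_trans vi ib.
have [tL|nt] := boolP (inL (take (size w).-1 w)); last first.
  have [|v vF vi] := IH (take (size w).-1 w) _ ht (sub _ it) nt.
    by rewrite size_take; case: ifP; slia.
  by exists v => //; apply: infix_trans vi it.
by exists w; rewrite ?infix_refl // /forbidden ws nw bL tL.
Qed.

Variables (T : Type) (op : T -> T -> T) (iA : A -> T) (iG : gT -> T).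
Hypothesis opA : associative op.
Hypothesis rel : relations inL f op iA iG.
Local Notation ev := (gev op iA iG).
Local Notation "a ** b" := (oprod op a b) (at level 40, left associativity).
Local Notation good := (good_letters inL (gT := gT)).

Lemma good_cat z1 z2 : good (z1 ++ z2) = good z1 && good z2.
Proof. exact: all_cat. Qed.

Lemma word_or_group (z : seq (A + gT)) :
  (exists w, z = map inl w) \/ (exists z1 k z2, z = z1 ++ inr k :: z2).
Proof.
elim: z => [|[a|k] z [[w ->]|[z1 [k' [z2 ->]]]]].
- by left; exists [::].
- by left; exists (a :: w).
- by right; exists (inl a :: z1), k', z2.
- by right; exists [::], k, (map inl w).
- by right; exists (inr k :: z1), k', z2.
Qed.

Lemma good_word w : good (map inl w) = all (fun a => inL [:: a]) w.
Proof. by rewrite /good_letters all_map; apply: eq_all. Qed.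

Lemma ev_groupM k l : ev [:: inr k] ** ev [:: inr l] = ev [:: inr (k * l)%g].
Proof. by case: rel => h _ _ /=; rewrite h. Qed.

(** Induction on length. A word outside L is cut at a minimal factor [v] outside L: the relation
    doubles the inner part of [v], yet each of the two pieces around [f v] is shorter than the
    whole. *)
Lemma sandwich z : good z ->
  exists k, ev [:: inr 1%g] ** ev z ** ev [:: inr 1%g] = ev [:: inr k].
Proof.
have oA := oprodA opA.
have [n] := ubnP (size z); elim: n z => // n IH z sz gz.
have [[w e]|[z1 [k [z2 e]]]] := word_or_group z; last first.
  subst z; have /andP[g1 /andP[_ g2]] := eqbLR (good_cat _ _) gz.
  rewrite size_cat [size (_ :: _)]/= in sz.
  have [|k1 e1] := IH z1 _ g1; first by slia.
  have [|k2 e2] := IH z2 _ g2; first by slia.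
  exists (k1 * k * k2)%g; rewrite -!ev_groupM -e1 -e2.
  have -> : ev (z1 ++ inr k :: z2) =
    ev z1 ** (ev [:: inr 1%g] ** ev [:: inr k] ** ev [:: inr 1%g]) ** ev z2.
    by rewrite !ev_groupM mul1g mulg1 gev_cat // gev_cons !oA.
  by rewrite !oA.
subst z; have [w0|w0] := eqVneq w [::].
  by subst w; exists (1 * 1)%g; rewrite -ev_groupM oprods0.
have [wL|nw] := boolP (inL w).
  by exists (f w); rewrite gev_word; case: rel => _ h _; apply: h.
rewrite good_word in gz.
have [v vF /infixP[l [r e]]] := forbidden_infix w0 gz nw.
have := ev_forbidden opA rel (map inl l) (map inl r) vF.
rewrite -!map_cat -e => ->.
have sv : 1 < size v by case/and4P: vF.
rewrite size_map e !size_cat in sz.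
have sub u : {subset u <= w} -> good (map inl u).
  by move=> uw; rewrite good_word; apply/allP => a /uw; apply: (allP gz).
have [||k1 e1] := IH (map inl (l ++ take (size v).-1 v)).
- by rewrite size_map size_cat size_take; case: ifP; slia.
- apply: sub => a; rewrite e !mem_cat => /orP[->//|/mem_take ->].
  by rewrite orbT.
have [||k2 e2] := IH (map inl (behead v ++ r)).
- by rewrite size_map size_cat size_behead; slia.
- apply: sub => a; rewrite e !mem_cat => /orP[/mem_behead->|->]; by rewrite ?orbT.
exists (k1 * f v * k2)%g; rewrite -!ev_groupM -e1 -e2.
have -> : ev (map inl l ++ map inl (take (size v).-1 v) ++ inr (f v) :: map inl (behead v ++ r)) =
  ev (map inl (l ++ take (size v).-1 v)) **
   (ev [:: inr 1%g] ** ev [:: inr (f v)] ** ev [:: inr 1%g]) ** ev (map inl (behead v ++ r)).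
  by rewrite !ev_groupM mul1g mulg1 catA -map_cat gev_cat // gev_cons !oA.
by rewrite !oA.
Qed.

Hypothesis gens : forall t, exists z : seq (A + gT), [/\ z != [::], good z & ev z = Some t].

Lemma idem_has_group e : op e e = e ->
  exists z1 k z2, [/\ good z1, good z2 & Some e = ev z1 ** ev [:: inr k] ** ev z2].
Proof.
move=> ee; have [z [z0 gz ez]] := gens e.
have [[w e']|[z1 [k [z2 e']]]] := word_or_group z; last first.
  subst z; move: gz; rewrite good_cat /= => /andP[g1 g2]; exists z1, k, z2; split=> //.
  by rewrite -ez gev_cat // gev_cons (oprodA opA).
subst z; have w0 : w != [::] by case: (w) z0.
have pw n : ev (map inl (wpow w n.+1)) = Some e.
  elim: n => [|n IH]; first by rewrite wpow1.
  by rewrite wpowS map_cat gev_cat // ez IH /= ee.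
rewrite good_word in gz.
(* Words of L have length at most [B], so the power [B.+1] of a non-empty word is outside L. *)
have nL : ~~ inL (wpow w B.+1).
  apply/negP => /size_inL; rewrite size_wpow leqNgt leq_pmulr //.
  by rewrite lt0n size_eq0.
have gw : all (fun a => inL [:: a]) (wpow w B.+1).
  by apply/allP => a /mem_wpow; apply: (allP gz).
have [|v vF /infixP[l [r e']]] := forbidden_infix _ gw nL.
  by rewrite -size_eq0 size_wpow -lt0n muln_gt0 /= lt0n size_eq0.
have := ev_forbidden opA rel (map inl l) (map inl r) vF.
rewrite -!map_cat -e' pw => ->.
have sub u : {subset u <= wpow w B.+1} -> good (map inl u).
  by move=> uw; rewrite good_word; apply/allP => a /uw; apply: (allP gw).
exists (map inl (l ++ take (size v).-1 v)), (f v), (map inl (behead v ++ r)); split.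
- apply: sub => a; rewrite e' !mem_cat => /orP[->//|/mem_take ->].
  by rewrite orbT.
- apply: sub => a; rewrite e' !mem_cat => /orP[/mem_behead->|->]; by rewrite ?orbT.
- by rewrite catA -map_cat gev_cat // gev_cons (oprodA opA).
Qed.

Lemma pres_local_group : local_group op.
Proof.
have oA := oprodA opA.
move=> e ee; have [z1 [g [z2 [g1 g2 eE]]]] := idem_has_group ee.
pose G k := ev [:: inr k]; pose P := ev z1; pose S := ev z2.
have GM k l : G k ** G l = G (k * l)%g by apply: ev_groupM.
have mid z : good z -> exists k, forall h h',
    G h ** ev z ** G h' = G (h * k * h')%g.
  move=> gz; have [k ek] := sandwich gz; exists k => h h'.
  by rewrite -!GM /G -ek -[h in LHS]mulg1 -[h' in LHS]mul1g -!ev_groupM !oA.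
(* [c] is what the middle [S ** P] of a product of two such elements contributes to the group. *)
have [c ec] : exists c, forall h h', G h ** S ** P ** G h' = G (h * c * h')%g.
  have [|c hc] := mid (z2 ++ z1); first by rewrite good_cat g1 g2.
  by exists c => h h'; rewrite -hc gev_cat // !oA.
have inG t : exists h, Some (op (op e t) e) = P ** G h ** S.
  have [zt [_ gt et]] := gens t.
  have [|k hk] := mid (z2 ++ zt ++ z1); first by rewrite !good_cat g1 g2 gt.
  exists (g * k * g)%g; rewrite -hk !gev_cat // et.
  rewrite -[Some (op (op e t) e)]/(Some e ** Some t ** Some e) eE.
  by rewrite -/P -/S -/(G _) !oA.
have rinv s : exists t, op (op (op e s) e) (op (op e t) e) = e.
  have [h eh] := inG s.
  (* The solution of $hcgc\,k\,cg=g$: the left side is the group part of [(e s e)(e t e)] for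
     [t = P k S], the right side that of [e]. *)
  pose k := ((h * c * g * c)^-1 * g * (c * g)^-1)%g.
  have [t et] : exists t, P ** G k ** S = Some t.
    have [|t et] := @gev_neq0 _ _ _ _ op iA iG (z1 ++ inr k :: z2); first by case: (z1).
    by exists t; rewrite -et gev_cat // gev_cons !oA.
  exists t; apply: Some_inj; rewrite -[LHS]/(Some (op (op e s) e) ** (Some e ** Some t ** Some e)).
  rewrite eh -et eE -/P -/S -/(G _).
  transitivity (P ** ((G h ** S ** P ** G g) ** S ** P ** ((G k ** S ** P ** G g))) ** S).
    by rewrite !oA.
  rewrite !ec; congr (_ ** _ ** _); congr G.
transitivity ((h * c * g * c) * k * (c * g))%g; first by rewrite !mulgA.
  by rewrite /k -[(_^-1 * g * _)%g]mulgA mulKVg mulgKV.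
(* A right inverse that itself has a right inverse is two-sided. *)
move=> s; have [t st] := rinv s; have [r tr] := rinv t; exists t; split => //.
have eK y : op (op (op e y) e) e = op (op e y) e by rewrite -opA ee.
have Ke y : op e (op (op e y) e) = op (op e y) e by rewrite !opA ee.
have := opA (op (op e s) e) (op (op e t) e) (op (op e r) e).
by rewrite tr st eK Ke => ->.
Qed.
End LocalGroup.

(** * The product of f along the prefixes of a word *)

Section Total.
Context (d : Order.disp_t) (A : orderType d) (gT : finGroupType).
Variables (inL : pred (seq A)) (f : seq A -> gT).
Implicit Types (v w s p : seq A).
Hypothesis inL_infix : forall v w, inL w -> infix v w -> v != [::] -> inL v.
Hypothesis f_maximal : forall w a, f w != 1%g -> inL (rcons w a) = false.

Local Notation run := (run inL f).
Local Notation lsuf := (lsuf inL).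

(* A letter read inside L multiplies this by f of the new suffix because f of the old
   one is then 1; a letter read outside L pushes the old factor into the middle. *)
Definition group_value (st : state A gT) : gT :=
  if st.1 is Some pg then (f pg.1 * pg.2 * f st.2)%g else f st.2.

Fixpoint prefix_prod p w : gT :=
  if w is a :: w' then (f (lsuf (rcons p a)) * prefix_prod (rcons p a) w')%g else 1%g.

Lemma prefix_prod_cat p w1 w2 :
  prefix_prod p (w1 ++ w2) = (prefix_prod p w1 * prefix_prod (p ++ w1) w2)%g.
Proof.
elim: w1 p => [|a w IH] p /=; first by rewrite mul1g cats0.
by rewrite IH mulgA cat_rcons.
Qed.

Lemma group_value_step st a : group_value (step inL f st (inl a)) =
  (group_value st * f (lsuf (rcons st.2 a)))%g.
Proof.
rewrite -(step_suffix2 inL f); case: st => o s /=; case: ifP => h.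
  have fs : f s = 1%g by apply/eqP; apply: contraTT h => /f_maximal ->.
  by case: o => [[p g]|]; rewrite /group_value /= fs ?mulg1 ?mul1g.
by case: o => [[p g]|]; rewrite /group_value /= !mulg1 // !mulgA.
Qed.

Lemma run_suffix2 w : inL [::] = false -> (run (triv A gT) (map inl w)).2 = lsuf w.
Proof.
move=> inL0; elim/last_ind: w => [|w a IH]; first by rewrite /= inL0.
rewrite map_rcons run_rcons step_suffix2 IH.
apply: lsuf_rcons => //; [exact: suffix_refl | exact: lsuf_suffix].
Qed.

Lemma group_value_run w : inL [::] = false -> f [::] = 1%g ->
  group_value (run (triv A gT) (map inl w)) = prefix_prod [::] w.
Proof.
move=> inL0 f0; elim/last_ind: w => [|w a IH]; first by rewrite /group_value /= f0.
rewrite map_rcons run_rcons group_value_step IH run_suffix2 // -[in RHS]cats1 prefix_prod_cat /= mulg1.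
congr (_ * f _)%g; apply: lsuf_rcons => //; [|exact: lsuf_suffix].
exact: suffix_refl.
Qed.

(** The left end is frozen at the first overflow and never changes afterwards; this is how a state
    remembers the beginning of the word. *)
Lemma run_prefix w : inL [::] = false ->
  match run (triv A gT) (map inl w) with
  | (None, s) => s = w /\ inL1 inL w
  | (Some pg, _) => inL1 inL pg.1 /\ exists2 a, prefix (rcons pg.1 a) w & ~~ inL (rcons pg.1 a)
  end.
Proof.
move=> inL0; elim/last_ind: w => [|w a] //.
rewrite map_rcons run_rcons; case: (run _ _) => -[[p g]|] s /=.
  by case=> pL [b pw nb]; case: ifP => _ /=; split => //; exists b => //;
     apply: prefix_trans pw (prefix_rcons _ _).
case=> -> wL; case: ifP => h /=; first by rewrite inL1_rcons h.
by split => //; exists a; rewrite ?h ?prefix_refl.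
Qed.
End Total.

(** * Values of kappa-terms *)

Section TermEval.
Context (d : Order.disp_t) (A : orderType d).
Variables (T : finType) (op : T -> T -> T) (phi : A -> T).
Hypothesis opA : associative op.
Implicit Types (v w y : seq A).
Local Notation N := (#|T|)`!.

(** Obtained by writing $\omega-1$ as the exponent $2N-1$; the result is positive and congruent to
    [k] modulo $N$. *)
Definition omega_exp (k : int) : nat :=
  match k with Posz k => (2 * N - 1) + k.+1 | Negz k => (2 * N - 1) * k.+1 end.

Lemma kevals_cons t s : kevals op phi (t :: s) = oprod op (keval op phi t) (kevals op phi s).
Proof. by []. Qed.

Lemma kevals_cat s1 s2 : kevals op phi (s1 ++ s2) = oprod op (kevals op phi s1) (kevals op phi s2).
Proof. by elim: s1 => // t s IH; rewrite cat_cons !kevals_cons IH (oprodA opA). Qed.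

Lemma keval_pow s : keval op phi (KPow s) = omap (omega_m1 op) (kevals op phi s).
Proof. by rewrite /=; congr omap; elim: s => // t s /= ->. Qed.

Lemma kevals_letters w : kevals op phi (map KLet w) = wprod op phi w.
Proof. by elim: w => // a w IH; rewrite map_cons kevals_cons IH. Qed.

Lemma wprod_cat v w : wprod op phi (v ++ w) = oprod op (wprod op phi v) (wprod op phi w).
Proof. by rewrite -!kevals_letters map_cat kevals_cat. Qed.

Lemma wprod_neq0 w : w != [::] -> exists t, wprod op phi w = Some t.
Proof. by case: w => // a w _ /=; case: (wprod op phi w) => [t|]; eexists. Qed.

Lemma wprod_wpow w t k : wprod op phi w = Some t ->
  wprod op phi (wpow w k.+1) = Some (spow op t k.+1).
Proof.
move=> e; elim: k => [|k IH]; first by rewrite wpow1 e.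
by rewrite wpowS wprod_cat IH e.
Qed.

Lemma keval_omega y : y != [::] ->
  keval op phi (KPow (map KLet y)) = wprod op phi (wpow y (2 * N - 1)).
Proof.
move=> y0; rewrite keval_pow kevals_letters; have [t e] := wprod_neq0 y0.
rewrite e /= /omega_m1; move: N (fact_gt0 #|T|) => M M0.
have -> : 2 * M - 1 = (2 * M - 2).+1 by lia.
by rewrite (wprod_wpow _ e).
Qed.

Lemma kevals_kpow y k : y != [::] ->
  kevals op phi (kpow_term y k) = wprod op phi (wpow y (omega_exp k)).
Proof.
move=> y0; case: k => k; rewrite /kpow_term /omega_exp.
  by rewrite kevals_cons keval_omega // kevals_letters wpowD [in RHS]wprod_cat.
elim: k.+1 => [|j IH]; first by rewrite muln0.
by rewrite mulnS wpowD wprod_cat -IH -keval_omega.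
Qed.

Lemma kevals_build v bl : all (fun b => b.1.1 != [::]) bl ->
  kevals op phi (build v bl) =
  wprod op phi (v ++ flatten [seq wpow b.1.1 (omega_exp b.1.2) ++ b.2 | b <- bl]).
Proof.
move=> h; rewrite /build kevals_cat wprod_cat kevals_letters; congr oprod.
elim: bl h => // b bl IH /andP[b0 h].
rewrite !map_cons /= -!/(flatten _) !kevals_cat !wprod_cat kevals_kpow //.
by rewrite kevals_letters IH.
Qed.
End TermEval.

Lemma sum2_le (I : eqType) (s : seq I) (F : I -> nat) i j :
  uniq s -> i \in s -> j \in s -> i != j -> F i + F j <= \sum_(k <- s) F k.
Proof.
move=> us is_ js ij; rewrite (bigD1_seq i) //= leq_add2l.
by rewrite big_mkcond (bigD1_seq j) //= eq_sym ij leq_addr.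
Qed.
Lemma sum1_le (I : eqType) (s : seq I) (F : I -> nat) i :
  uniq s -> i \in s -> F i <= \sum_(k <- s) F k.
Proof. by move=> us is_; rewrite (bigD1_seq i) //= leq_addr. Qed.

Lemma canonical_blocks (d : Order.disp_t) (A : orderType d) (x u : nat -> seq A)
    (q : nat -> int) v a k :
  canonical_aux v [seq (x i, q i, u i) | i <- iota a k.+1] ->
  [/\ ~~ suffix (x a) v,
      forall i, a <= i <= a + k -> lyndon (x i),
      forall i, a <= i < a + k -> ~~ suffix (x i.+1) (u i) /\
        ~~ prefix (x i) (u i ++ wpow (x i.+1) (size (x i))) &
      ~~ prefix (x (a + k)) (u (a + k))].
Proof.
elim: k a v => [|k IH] a v.
  case=> la sa pa _; split=> //; last 2 first.
  - by move=> i; rewrite addn0 ltnNge andbN.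
  - by rewrite addn0; move: pa => /=; rewrite /wpow; elim: (size _) => [|j IH] /=; rewrite ?cats0.
  by move=> i; rewrite addn0 -eqn_leq => /eqP <-.
rewrite -[iota a k.+2]/(a :: iota a.+1 k.+1) map_cons => -[la sa pa /IH[sb lb ib eb]].
rewrite addnS -addSn; split => //.
  move=> i; rewrite leq_eqVlt => /andP[/orP[/eqP <- //|ai] ik]; apply: lb; lia.
move=> i; rewrite leq_eqVlt => /andP[/orP[/eqP <- //|ai] ik]; apply: ib; lia.
Qed.

(** * Special words in rank 1 terms *)

Section Rank1.
Context (d : Order.disp_t) (A : orderType d) (a0 : A).
Variables (m n : nat) (u0' um' : seq A) (x u : nat -> seq A) (q : nat -> int).
Local Notation D := (RData m n u0' um' x u q).
Context (gT : finGroupType) (g : var A -> gT) (ii jj kk : nat).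
Hypothesis mn : 0 < m < n.
Hypothesis can1 : canonical u0' (blocks D 1 m).
Hypothesis can2 : canonical um' (blocks D m.+1 n).
Hypothesis iiP : ii_ok D ii.
Hypothesis ij : ii < jj.
Hypothesis kkP : kk_ok D g jj kk.
Implicit Types (v w p : seq A).

Local Notation inL := (inL D ii jj kk).
Local Notation fval := (fval D g jj kk).

Lemma mem_In i : (i \in In D) = (0 < i <= n).
Proof. by rewrite mem_iota /= add1n ltnS. Qed.
Lemma mem_Imn i : (i \in Imn D) = [&& 0 < i, i < n & i != m].
Proof. by rewrite mem_filter mem_In /=; lia. Qed.
Lemma Imn_In i : i \in Imn D -> i \in In D /\ i.+1 \in In D.
Proof. by rewrite mem_Imn !mem_In; lia. Qed.

(* lets pi and rho be treated at once: v is the initial word, a and b bound the blocks *)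
Definition seg v a b := (v = u0' /\ a = 1 /\ b = m) \/ (v = um' /\ a = m.+1 /\ b = n).

Lemma seg_canonical v a b : seg v a b ->
  [/\ ~~ suffix (x a) v,
      forall i, a <= i <= b -> lyndon (x i),
      forall i, a <= i < b -> ~~ suffix (x i.+1) (u i) /\
        ~~ prefix (x i) (u i ++ wpow (x i.+1) (size (x i))) &
      ~~ prefix (x b) (u b)].
Proof.
case=> -[-> [-> ->]].
  have := @canonical_blocks _ _ x u q u0' 1 (m - 1) can1.
  by rewrite subnKC //; lia.
have := @canonical_blocks _ _ x u q um' m.+1 (n - m.+1) can2.
by rewrite subnKC //; lia.
Qed.

Lemma seg1 : seg u0' 1 m. Proof. by left. Qed.
Lemma seg2 : seg um' m.+1 n. Proof. by right. Qed.

Lemma lyndon_x i : i \in In D -> lyndon (x i).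
Proof.
rewrite mem_In => /andP[i0 iN]; have [le|lt] := leqP i m.
  by have [_ h _ _] := seg_canonical seg1; apply: h; rewrite i0.
by have [_ h _ _] := seg_canonical seg2; apply: h; rewrite lt.
Qed.

Lemma Imn_canonical i : i \in Imn D -> ~~ suffix (x i.+1) (u i) /\
        ~~ prefix (x i) (u i ++ wpow (x i.+1) (size (x i))).
Proof.
rewrite mem_Imn => /and3P[i0 iN im]; have [lt|le] := ltnP i m.
  by have [_ _ h _] := seg_canonical seg1; apply: h; rewrite i0.
by have [_ _ h _] := seg_canonical seg2; apply: h; lia.
Qed.

Lemma x_gt0 i : i \in In D -> 0 < size (x i).
Proof. by move/lyndon_x/lyndon_gt0. Qed.
Lemma x_neq0 i : i \in In D -> x i != [::].
Proof. by move/lyndon_x/lyndon_neq0. Qed.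

(** In the canonicity condition, [size (x i)] copies of [x i.+1] already cover every position that a
    prefix [x i] could see, so the exponent is immaterial. *)
Lemma Imn_nprefix i M : i \in Imn D -> ~~ prefix (x i) (u i ++ wpow (x i.+1) M).
Proof.
move=> iI; have [_] := Imn_canonical iI; apply: contra => h.
have [_ /x_gt0 s1] := Imn_In iI.
apply: (@prefix_cat_size _ _ _ _ (wpow (x i.+1) M)).
  rewrite -catA -wpowD addnC wpowD catA; exact: prefix_catl.
by rewrite size_cat size_wpow (leq_trans (leq_pmulr _ s1)) // leq_addl.
Qed.

Definition sum_size_x := \sum_(i <- In D) size (x i).
Definition sum_size_u := size u0' + size um' + \sum_(i <- In D) size (u i).

Lemma size_bound : sum_size_x + sum_size_u < ii.
Proof.
have fl (s : seq nat) : size (flatten [seq x i ++ u i | i <- s]) =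
    \sum_(i <- s) size (x i) + \sum_(i <- s) size (u i).
  elim: s => [|i s IH]; rewrite ?big_nil // !big_cons /= size_cat IH size_cat; lia.
move: iiP; rewrite /ii_ok /= !size_cat !fl; apply: leq_trans.
rewrite /sum_size_x /sum_size_u /In /=.
have -> : iota 1 n = iota 1 m ++ iota m.+1 (n - m).
  by rewrite -[m.+1]/(1 + m) -iotaD subnKC //; lia.
by rewrite !big_cat /=; lia.
Qed.

Definition short v := size v <= sum_size_u.
Lemma short_u i : i \in In D -> short (u i).
Proof.
move=> iI; rewrite /short /sum_size_u (leq_trans (sum1_le (fun i => size (u i)) _ iI)) ?iota_uniq //.
exact: leq_addl.
Qed.
Lemma short_seg v a b : seg v a b -> short v.
Proof. by case=> -[-> _]; rewrite /short /sum_size_u; lia. Qed.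

(** The two strict inequalities leading from the total length to [ii] and on to [jj] pay for the two
    extra copies of [x r]. *)
Lemma power_bound r N : r \in In D -> jj <= N -> sum_size_x + sum_size_u + 2 * size (x r) <= N * size (x r).
Proof.
move=> /x_gt0 r0 jN; have := size_bound => sb.
apply: (@leq_trans ((sum_size_x + sum_size_u + 2) * size (x r))); last by rewrite leq_mul2r; lia.
by rewrite mulnDl leq_add2r leq_pmulr.
Qed.

(** The indices must differ, so that both lengths are counted in [sum_size_x]. *)
Lemma host_bound v r N i i' : r \in In D -> jj <= N -> short v -> i \in In D -> i' \in In D ->
  i != i' -> size v + size (x i) + size (x i') + 2 * size (x r) <= N * size (x r).
Proof.
move=> rI jN uv iI iI' ne; apply: leq_trans (power_bound rI jN).
have := sum2_le (fun i => size (x i)) (iota_uniq _ _) iI iI' ne.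
by rewrite -/sum_size_x leq_add2r; move: uv; rewrite /short; lia.
Qed.

Lemma x_le_jj r : r \in In D -> size (x r) <= jj.
Proof.
move=> rI; have := sum1_le (fun i => size (x i)) (iota_uniq _ _) rI.
by rewrite -/sum_size_x; have := size_bound; lia.
Qed.

Lemma jj_kk : jj < kk. Proof. by case: kkP. Qed.

(** Supplies a second index for hosts with a single power, where the other exponent is 0. *)
Lemma other_index i : i \in In D -> exists2 i', i' \in In D & i != i'.
Proof.
rewrite mem_In => iI; have [e|ne] := eqVneq i 1.
  by exists n; rewrite ?mem_In; lia.
by exists 1; rewrite ?mem_In; lia.
Qed.

(** The words on which [f] may be nontrivial, those of $W_{\mathbb j}$ and $W'_{\mathbb k}$. *)
Definition special w := (exists2 i, i \in Imn D & w = Wj_i D jj i) \/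
  (exists2 i, i \in In D & w = wpow (x i) kk).

Lemma kk_nfactor i r : i \in In D -> r \in Imn D -> ~~ infix (wpow (x i) kk) (Wj_i D jj r).
Proof.
move=> iI rI; case: kkP => _ h _; rewrite -[x i]rot0; apply: h => //; first exact: x_gt0.
by apply/mapP; exists r.
Qed.

Section SpecialHost.
Variables (i i' : nat) (v : seq A) (M M' : nat).
Hypotheses (iI : i \in In D) (iI' : i' \in In D) (ne : i != i') (uv : short v).
Hypothesis npre : 0 < M -> ~~ prefix (x i) (v ++ wpow (x i') M').
Hypothesis nsuf : 0 < M' -> ~~ suffix (x i') v.

Lemma occ_x r N p p' : r \in In D -> jj <= N ->
  wpow (x i) M ++ v ++ wpow (x i') M' = p ++ wpow (x r) N ++ p' ->
  (x r = x i /\ size p = M * size (x i) %[mod size (x i)] /\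
     size p + N * size (x r) <= M * size (x i)) \/
  (x r = x i' /\ size p = M * size (x i) + size v %[mod size (x i')] /\
     M * size (x i) + size v < size p + N * size (x r)).
Proof.
move=> rI jN e.
exact: (occ_power a0 (lyndon_x iI) (lyndon_x iI') npre (lyndon_x rI) e (host_bound rI jN uv iI iI' ne)).
Qed.

Lemma occ_Wj r p p' : r \in Imn D ->
  wpow (x i) M ++ v ++ wpow (x i') M' = p ++ Wj_i D jj r ++ p' ->
  [/\ x r = x i, x r.+1 = x i', u r = v & size p + jj * size (x i) = M * size (x i)].
Proof.
move=> rI e; have [r1 r2] := Imn_In rI.
have [//||||||e1 e2 e3 e4] :=
  @occ_transition _ _ a0 (x i) v (x i') M M' (lyndon_x iI) (lyndon_x iI') npre nsuf
    (x r) (u r) (x r.+1) jj p p' (lyndon_x r1) (lyndon_x r2).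
- exact: host_bound.
- exact: host_bound.
- exact: x_le_jj.
- exact: Imn_nprefix.
- by case: (Imn_canonical rI).
by split => //; rewrite -{1}e1.
Qed.
End SpecialHost.

Lemma pure_occ i r N M p p' : i \in In D -> r \in In D -> jj <= N ->
  wpow (x i) M = p ++ wpow (x r) N ++ p' ->
  x r = x i /\ size p = M * size (x i) %[mod size (x i)].
Proof.
move=> iI rI jN e; have [i' iI' ne] := other_index iI.
have sz : M * size (x i) = size p + N * size (x r) + size p'.
  by rewrite -size_wpow e !size_cat size_wpow addnA.
have [|||[-> [-> _]]|[_ [_]]] // := @occ_x i i' [::] M 0 iI iI' ne _ _ r N p p' rI jN.
- by move=> _; rewrite cats0 prefixs0 x_neq0.
- by rewrite cats0.
by rewrite addn0 sz ltnNge leq_addr.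
Qed.

(** In a word of $W_{\mathbb j}$ the first power would have to end exactly at the end of the host,
    leaving no room for the second one. *)
Lemma special_pure i w p p' M : i \in In D -> special w ->
  wpow (x i) M = p ++ w ++ p' -> w = wpow (x i) kk.
Proof.
move=> iI [[r rI ->]|[r rI ->]] e; last first.
  by have [-> //] := pure_occ iI rI (ltnW jj_kk) e.
have [i' iI' ne] := other_index iI; have [r1 r2] := Imn_In rI.
have [||||e1 e2 e3 e4] // := @occ_Wj i i' [::] M 0 iI iI' ne _ _ _ r p p' rI.
- by move=> _; rewrite cats0 prefixs0 x_neq0.
- by rewrite cats0.
have := congr1 size e; rewrite !size_cat !size_wpow -e4 /= e1.
have := x_gt0 r2; have : 0 < jj by lia.
by case: (jj) => // j _; case: (size (x r.+1)) => // l _; lia.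
Qed.

Lemma modn_multiple l a b : a = b %[mod l] -> a <= b -> exists s, b = a + s * l.
Proof.
move=> e ab; have /dvdnP[s h] : l %| b - a by rewrite -eqn_mod_dvd ?e.
by exists s; rewrite -h subnKC.
Qed.

Lemma cat_power_prefix v y w p c N p' : v ++ w = p ++ wpow y N ++ p' ->
  size v = size p + c * size y -> c <= N -> v = p ++ wpow y c.
Proof.
move=> e sv cN; move/(congr1 (take (size v))): e.
rewrite take_size_cat // => ->; rewrite sv -(subnKC cN) wpowD -catA catA take_size_cat //.
by rewrite size_cat size_wpow.
Qed.

(** The power is in phase with the run of [x a]. If it ended after fewer than [kk] copies of the
    run, it would begin inside [v], and [x a] would be a suffix of [v]. *)
Lemma special_left v a b w p p' M : seg v a b -> special w ->
  v ++ wpow (x a) M = p ++ w ++ p' ->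
  w = wpow (x a) kk /\
  exists s, kk <= s <= M /\ size p + size w = size v + s * size (x a).
Proof.
move=> sg spw e; have aI : a \in In D by rewrite mem_In; case: sg => -[_ [-> _]]; lia.
have [i iI ne] := other_index aI; rewrite eq_sym in ne.
have [nsuf _ _ _] := seg_canonical sg; have uv := short_seg sg; have a1 := x_gt0 aI.
case: spw e => [[r rI ->]|[r rI ->]] e.
  have [||_ _ _] // := @occ_Wj i a v 0 M iI aI ne uv _ _ r p p' rI e.
  by rewrite mul0n => /eqP; rewrite addn_eq0 muln_eq0; have := x_gt0 iI; lia.
have [|[_ [_]]|[er [e1 lt]]] // := @occ_x i a v 0 M iI aI ne uv _ r kk p p' rI (ltnW jj_kk) e.
  by rewrite mul0n leqn0 addn_eq0 muln_eq0; have := x_gt0 rI; have := jj_kk; slia.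
rewrite er mul0n add0n in e e1 lt *; split=> //; rewrite size_wpow.
have [||s es] := @modn_multiple (size (x a)) (size v) (size p + kk * size (x a)).
- by rewrite modn_addM e1.
- exact: ltnW.
exists s; split => //; apply/andP; split; last first.
  rewrite -(leq_pmul2r a1) -(leq_add2l (size v)) -es.
  by have := congr1 size e; rewrite !size_cat !size_wpow; slia.
rewrite leqNgt; apply/negP => sk; move/negP: nsuf; apply.
rewrite (@cat_power_prefix v (x a) (wpow (x a) M) p (kk - s) kk p' e) ?leq_subr //.
  by case: (kk - s) (subn_gt0 s kk) => [|c]; rewrite ?sk // wpowSr catA suffix_suffix.
by apply: (@addIn (s * size (x a))); rewrite -es -addnA -mulnDl subnK // ltnW.
Qed.

Lemma special_right v a b w p p' M : seg v a b -> special w ->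
  wpow (x b) M ++ u b = p ++ w ++ p' ->
  w = wpow (x b) kk /\ size p + size w <= M * size (x b).
Proof.
move=> sg spw e; have bI : b \in In D by rewrite mem_In; case: sg => -[_ [_ ->]]; lia.
have [i iI ne] := other_index bI.
have [_ _ _ npre] := seg_canonical sg; have uv := short_u bI.
have e' : wpow (x b) M ++ u b ++ wpow (x i) 0 = p ++ w ++ p' by rewrite cats0.
have sz := congr1 size e; rewrite !size_cat size_wpow in sz.
case: spw e' sz => [[r rI ->]|[r rI ->]] e' sz.
  have [||e1 e2 e3 e4] // := @occ_Wj b i (u b) M 0 bI iI ne uv _ _ r p p' rI e'.
    by rewrite cats0.
  have [_ r2] := Imn_In rI; have := x_gt0 r2; have : 0 < jj by lia.
  move: sz; rewrite !size_cat !size_wpow /= e1 e3 -e4.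
  by case: (jj) => // j; case: (size (x r.+1)) => // l; lia.
have [|[er [_ le]]|[er [e1 lt]]] // := @occ_x b i (u b) M 0 bI iI ne uv _ r kk p p' rI (ltnW jj_kk) e'.
- by rewrite cats0.
- by rewrite size_wpow er in le *.
by move: lt; rewrite sz size_wpow addnA ltnNge leq_addr.
Qed.

Lemma tt_max i c : i \in Imn D ->
  suffix (wpow (x i.+1) c) (wpow (x i) jj ++ u i) -> c <= tt D jj i.
Proof.
move=> iI h; have [_ /x_gt0 y0] := Imn_In iI.
have lt : c < (size (wpow (x i) jj ++ u i)).+1.
  by rewrite ltnS (leq_trans _ (size_suffix h)) // size_wpow leq_pmulr.
exact: (@bigmax_sup _ (Ordinal lt)).
Qed.

Lemma tt_suffix i : suffix (wpow (x i.+1) (tt D jj i)) (wpow (x i) jj ++ u i).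
Proof.
rewrite /tt /=; set w := wpow (x i) jj ++ u i.
pose P := [pred t : 'I_(size w).+1 | suffix (wpow (x i.+1) t) w].
have [|t tP ->] := @eq_bigmax_cond _ P (@nat_of_ord _); last exact: tP.
by apply/card_gt0P; exists ord0; rewrite inE suffix0s.
Qed.

(** A power of [x i.+1] may begin before its run, since [wpow (x i) jj ++ u i] can end with copies
    of [x i.+1]; there are at most [tt] of these, whence the bound [kk <= s + tt D jj i]. *)
Lemma special_mid i w p p' M M' : i \in Imn D -> jj <= M -> special w ->
  wpow (x i) M ++ u i ++ wpow (x i.+1) M' = p ++ w ++ p' ->
  [\/ size p + size w <= M * size (x i),
      w = Wj_i D jj i /\
        size p + size w = M * size (x i) + size (u i) + jj * size (x i.+1) |
      w = wpow (x i.+1) kk /\ exists s, [/\ 0 < s, kk <= s + tt D jj i &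
        size p + size w = M * size (x i) + size (u i) + s * size (x i.+1)]].
Proof.
move=> iI jM spw e; have [i1 i2] := Imn_In iI.
have [nsuf _] := Imn_canonical iI; have npre := Imn_nprefix _ iI.
have uv := short_u i1; have y0 := x_gt0 i2; have ne : i != i.+1 by lia.
case: spw e => [[r rI ->]|[r rI ->]] e.
  have [||e1 e2 e3 e4] // := @occ_Wj i i.+1 (u i) M M' i1 i2 ne uv _ _ r p p' rI e.
  apply: Or32; rewrite /Wj_i /= e1 e2 e3; split=> //.
  by rewrite !size_cat !size_wpow -e4; slia.
have [|[er [_ le]]|[er [e1 lt]]] // := @occ_x i i.+1 (u i) M M' i1 i2 ne uv _ r kk p p' rI (ltnW jj_kk) e.
  by apply: Or31; rewrite size_wpow.
apply: Or33; rewrite er in e lt *; split=> //; rewrite size_wpow.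
have [||s es] := @modn_multiple (size (x i.+1)) (M * size (x i) + size (u i)) (size p + kk * size (x i.+1)).
- by rewrite modn_addM e1.
- exact: ltnW.
have s0 : 0 < s by case: s es => // es; move: lt; rewrite es addn0 ltnn.
exists s; split => //; have [//|sk] := leqP kk s; first by move=> h; apply: leq_trans h (leq_addr _ _).
rewrite -leq_subLR; set c := kk - s.
have es' : M * size (x i) + size (u i) = size p + c * size (x i.+1).
  by apply: (@addIn (s * size (x i.+1))); rewrite -es -addnA -mulnDl subnK // ltnW.
have exu : wpow (x i) M ++ u i = p ++ wpow (x i.+1) c.
  apply: (@cat_power_prefix _ _ (wpow (x i.+1) M') p c kk p'); rewrite ?leq_subr //.
    by rewrite -catA.
  by rewrite size_cat size_wpow.
have exu' : wpow (x i) M ++ u i = wpow (x i) (M - jj) ++ (wpow (x i) jj ++ u i).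
  by rewrite catA -wpowD subnK.
have [le|gt] := leqP (size (wpow (x i.+1) c)) (size (wpow (x i) jj ++ u i)).
  apply: tt_max => //; apply: (@suffix_cat_size _ _ _ _ (wpow (x i) (M - jj))) => //.
  by rewrite -exu' exu suffix_suffix.
(* If the copies in front covered all of $x_i^{jj}u_i$, then $x_{i+1}=x_i$ and $|u_i|$ would be a
   multiple of $|x_i|$. An empty $u_i$ contradicts the prefix condition, and a non-empty one would
   end with $x_{i+1}$. *)
have : suffix (wpow (x i) jj ++ u i) (wpow (x i.+1) c).
  apply: (@suffix_cat_size _ _ _ _ p); last exact: ltnW.
  by rewrite -exu exu' suffix_suffix.
case/suffixP=> p1 e2; have [exy e3] := pure_occ i2 i1 (leqnn jj) e2.
have sz := congr1 size e2; rewrite !size_cat !size_wpow exy in sz.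
have : size (u i) = 0 %[mod size (x i.+1)].
  apply/eqP; rewrite -(eqn_modDl (size p1 + jj * size (x i.+1))) addn0.
  by rewrite -addnA -sz modn_addM e3.
move/esym/modn_multiple => /(_ isT)[k]; rewrite add0n => ek.
case: k ek => [|k] ek.
  have := npre 1; rewrite exy wpow1 [u i]size0nil //.
  by rewrite prefix_refl.
move/negP: nsuf; case.
have kc : k.+1 <= c by rewrite -(leq_pmul2r y0) sz -ek; slia.
have : suffix (u i) (wpow (x i.+1) k.+1).
  apply: (@suffix_cat_size _ _ _ _ (wpow (x i.+1) (c - k.+1))).
    by rewrite -wpowD subnK // e2 catA suffix_suffix.
  by rewrite size_wpow ek.
by rewrite suffixE ek size_wpow subnn drop0 => /eqP <-; rewrite wpowSr suffix_suffix.
Qed.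

(** * The set L and the maximality of special words *)

Lemma wpow_rot (y : seq A) r k : r <= size y ->
  wpow y k.+1 = take r y ++ wpow (rot r y) k ++ drop r y.
Proof.
move=> ry; elim: k => [|k IH]; first by rewrite wpow1 cat_take_drop.
by rewrite wpowSr IH wpowSr /rot -!catA cat_take_drop.
Qed.

Definition Lgen := Wi D ii ++ Wj D jj ++ Wk D kk.

Lemma inLE w : inL w = (w != [::]) && has (fun z => infix w z) Lgen.
Proof. by []. Qed.

Lemma seg_Wi v a b : seg v a b ->
  v ++ wpow (x a) ii \in Wi D ii /\ wpow (x b) ii ++ u b \in Wi D ii.
Proof. by case=> -[-> [-> ->]]; rewrite !inE /= !eqxx !orbT. Qed.

(** In a word of $W_{\mathbb i}$ there is no room, as [ii < kk]. In a word of $W_{\mathbb j}$ the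
    choice of [kk] excludes the powers, so only the transition itself remains. A word of $W_{\mathbb
    k}$ is a factor of a pure power. *)
Lemma special_fit w z : special w -> z \in Lgen -> infix w z -> size w = size z.
Proof.
move=> spw zL /infixP[p [p' e]].
have left v a b : seg v a b -> z = v ++ wpow (x a) ii -> size w = size z.
  move=> sg ez; rewrite ez in e; have [_ [s [/andP[s1 s2] _]]] := special_left sg spw e.
  by have := jj_kk; lia.
have right v a b : seg v a b -> z = wpow (x b) ii ++ u b -> size w = size z.
  move=> sg ez; rewrite ez in e; have [-> h] := special_right sg spw e.
  have bI : b \in In D by rewrite mem_In; case: sg => -[_ [_ ->]]; lia.
  have /x_gt0 b0 := bI.
  move: h; rewrite size_wpow => h; have : kk * size (x b) <= ii * size (x b).
    by apply: leq_trans h; apply: leq_addl.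
  by rewrite leq_pmul2r //; have := jj_kk; lia.
move: zL; rewrite !mem_cat => /or3P[|/mapP[i iI ez]|].
- rewrite !inE /= => /or4P[]/eqP ez.
  + exact: left seg1 ez.
  + exact: left seg2 ez.
  + exact: right seg1 ez.
  + exact: right seg2 ez.
- have e' : wpow (x i) jj ++ u i ++ wpow (x i.+1) jj = p ++ w ++ p' by rewrite -e ez.
  have [i1 i2] := Imn_In iI.
  have nK r : r \in In D -> w <> wpow (x r) kk.
    move=> rI ew; move/negP: (kk_nfactor rI iI); apply; rewrite -ez e -ew.
    exact: infix_infix.
  have [le|[-> _]|[ew _]] := special_mid iI (leqnn _) spw e'.
  + have e2 : wpow (x i) jj = p ++ w ++ drop (size p + size w) (wpow (x i) jj).
      rewrite catA -{1}(cat_take_drop (size p + size w) (wpow (x i) jj)); congr (_ ++ _).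
      rewrite -(@take_size_cat _ (size p + size w) (p ++ w) p') ?size_cat //.
      by rewrite -catA -e' takel_cat // size_wpow.
    by case: (nK i i1); apply: special_pure e2.
  + by rewrite ez.
  + by case: (nK i.+1 i2).
- case/flattenP=> s /mapP[i iI ->] /mapP[r]; rewrite mem_iota => /andP[_ rx] ez.
  have ri : r <= size (x i) by rewrite ltnW.
  have e2 := wpow_rot kk ri; rewrite -ez e -!catA catA in e2.
  by rewrite (special_pure iI spw e2) ez !size_wpow size_rot.
Qed.

Lemma special_maximal w z : special w -> inL z -> infix w z -> z = w.
Proof.
move=> spw /andP[_ /hasP[W WL zW]] wz.
have sw := special_fit spw WL (infix_trans wz zW).
have e : size z = size w by apply/eqP; rewrite eqn_leq sw size_infix // -sw size_infix.
case/infixP: wz e => p [p' ->]; rewrite !size_cat.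
by case: p p' => [|b p] [|b' p'] //=; rewrite ?cats0 //; slia.
Qed.

Lemma fval_special w : fval w != 1%g -> special w.
Proof.
rewrite /fval /=; case E1: [seq i <- Imn D | w == Wj_i D jj i] => [|i s].
  case E2: [seq i <- In D | w == wpow (x i) kk] => [|i s]; first by rewrite eqxx.
  have : i \in [seq i <- In D | w == wpow (x i) kk] by rewrite E2 mem_head.
  by rewrite mem_filter => /andP[/eqP ew iI] _; right; exists i.
have : i \in [seq i <- Imn D | w == Wj_i D jj i] by rewrite E1 mem_head.
by rewrite mem_filter => /andP[/eqP ew iI] _; left; exists i.
Qed.

Lemma special_inL w : special w -> inL w.
Proof.
have kk0 : 0 < kk by have := jj_kk; lia.
case=> -[i iI ->]; rewrite inLE; apply/andP; split.
- have [/x_gt0 i1 _] := Imn_In iI; rewrite -size_eq0 /Wj_i !size_cat size_wpow -lt0n.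
  by rewrite ltn_addr // muln_gt0; apply/andP; split => //; lia.
- apply/hasP; exists (Wj_i D jj i); last exact: infix_refl.
  by rewrite !mem_cat map_f ?orbT.
- by have /x_gt0 i1 := iI; rewrite -size_eq0 size_wpow -lt0n muln_gt0 kk0.
- apply/hasP; exists (wpow (x i) kk); last exact: infix_refl.
  rewrite !mem_cat; apply/orP; right; apply/orP; right; apply/flattenP.
  exists [seq wpow (rot r (x i)) kk | r <- iota 0 (size (x i))].
    by apply/mapP; exists i.
  by apply/mapP; exists 0; rewrite ?rot0 // mem_iota /= add0n x_gt0.
Qed.

Lemma inL_infix v w : inL w -> infix v w -> v != [::] -> inL v.
Proof.
move=> /andP[_ /hasP[W WL wW]] vw v0; rewrite inLE v0.
by apply/hasP; exists W => //; apply: infix_trans vw wW.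
Qed.

Lemma fval_maximal w a : fval w != 1%g -> inL (rcons w a) = false.
Proof.
move/fval_special => spw; apply/negP => wa.
have := special_maximal spw wa (infix_rcons _ _) => /(congr1 size).
by rewrite size_rcons; lia.
Qed.

Lemma fval_forbidden v : forbidden inL v -> fval v = 1%g.
Proof.
by case/and4P=> _ nv _ _; apply/eqP; apply: contraNT nv => /fval_special/special_inL.
Qed.

Lemma fval0 : fval [::] = 1%g.
Proof. by apply/eqP/negPn/negP => /fval_special/special_inL. Qed.

(** Several indices may give the same word, and [fval] takes the first; the word determines both
    powers and the connecting word, so the value is the same for all of them. *)
Lemma fval_Wj i : i \in Imn D -> fval (Wj_i D jj i) = fW D g jj i.
Proof.
move=> iI; rewrite /fval /=.
have : i \in [seq r <- Imn D | Wj_i D jj i == Wj_i D jj r] by rewrite mem_filter eqxx.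
case E: [seq r <- Imn D | Wj_i D jj i == Wj_i D jj r] => [|r s] // _.
have : r \in [seq r <- Imn D | Wj_i D jj i == Wj_i D jj r] by rewrite E mem_head.
rewrite mem_filter => /andP[/eqP e rI]; have [i1 i2] := Imn_In iI.
have [nsuf _] := Imn_canonical iI.
have ne : i != i.+1 by lia.
have e' : wpow (x i) jj ++ u i ++ wpow (x i.+1) jj = [::] ++ Wj_i D jj r ++ [::].
  by rewrite cats0 -e.
have [||e1 e2 e3 _] // := @occ_Wj i i.+1 (u i) jj jj i1 i2 ne (short_u i1) _ _ r [::] [::] rI e'.
  by move=> _; apply: Imn_nprefix.
by rewrite /fW /tt /= e1 e2 e3.
Qed.

Lemma fval_power i : i \in In D -> fval (wpow (x i) kk) = g (inl (x i)).
Proof.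
move=> iI; rewrite /fval /=.
case E: [seq r <- Imn D | wpow (x i) kk == Wj_i D jj r] => [|r s].
  have : i \in [seq r <- In D | wpow (x i) kk == wpow (x r) kk] by rewrite mem_filter eqxx.
  case E': [seq r <- In D | wpow (x i) kk == wpow (x r) kk] => [|r s] // _.
  have : r \in [seq r <- In D | wpow (x i) kk == wpow (x r) kk] by rewrite E' mem_head.
  rewrite mem_filter => /andP[/eqP e rI].
  have [|-> //] := @pure_occ i r kk kk [::] [::] iI rI (ltnW jj_kk).
  by rewrite cats0.
have : r \in [seq r <- Imn D | wpow (x i) kk == Wj_i D jj r] by rewrite E mem_head.
rewrite mem_filter => /andP[/eqP e rI]; have /negP[] := kk_nfactor iI rI.
by rewrite e infix_refl.
Qed.

(** * The product of f along a rank 1 word *)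

Definition hval p := fval (lsuf inL p).

(** By maximality in L, a special suffix is the longest suffix in L. *)
Lemma hval_special w p : special w -> suffix w p -> hval p = fval w.
Proof.
move=> spw wp; rewrite /hval; congr fval; have wL := special_inL spw.
have wl : suffix w (lsuf inL p) by apply: lsuf_max => //; rewrite /inL1 wL orbT.
case/orP: (lsuf_inL1 inL p) => [/eqP e|lL]; last exact: special_maximal (suffixW wl).
by move: wl; rewrite e suffixs0 => /eqP ->.
Qed.

Lemma hval_none p : (forall w, special w -> suffix w p -> False) -> hval p = 1%g.
Proof.
move=> h; apply/eqP/negPn/negP => /fval_special spw.
exact: h spw (lsuf_suffix inL p).
Qed.

Lemma hval_neq1 p : hval p != 1%g -> exists2 w, special w & suffix w p.
Proof. by move/fval_special => spw; exists (lsuf inL p) => //; apply: lsuf_suffix. Qed.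

Local Notation PP := (prefix_prod inL fval).

Lemma prefix_prod_last p w : w != [::] ->
  (forall k, 0 < k < size w -> hval (p ++ take k w) = 1%g) -> PP p w = hval (p ++ w).
Proof.
elim: w p => [|a [|b w] IH] p // _ h.
  by rewrite /= mulg1 cats1.
have -> : PP p [:: a, b & w] = (hval (rcons p a) * PP (rcons p a) (b :: w))%g by [].
have -> : hval (rcons p a) = 1%g by rewrite -cats1 -(h 1).
rewrite mul1g IH ?cat_rcons // => k kl.
by case/andP: kl => _ kl; rewrite cat_rcons -(h k.+1).
Qed.

Lemma prefix_prod_one p w : (forall k, 0 < k <= size w -> hval (p ++ take k w) = 1%g) ->
  PP p w = 1%g.
Proof.
have [-> //|w0] := eqVneq w [::] => h.
rewrite prefix_prod_last // => [|k kl]; last by apply: h; lia.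
by rewrite -(h (size w)) ?take_size // leqnn lt0n size_eq0 w0.
Qed.

(** Common to the first run and to those after a connecting word: factors other than 1 occur only at
    ends of copies of [y], namely [F] at the [J]-th and [c] from the [K]-th on. Truncated
    subtraction covers the runs too short to reach [K]. *)
Lemma prefix_prod_powers p v (y : seq A) M (F c : gT) J K : 0 < size y -> 0 < J < K ->
  (forall k, 0 < k <= size v + M * size y -> hval (p ++ take k (v ++ wpow y M)) != 1%g ->
     exists2 s, 0 < s & k = size v + s * size y) ->
  (forall s, 0 < s <= M -> hval (p ++ v ++ wpow y s) =
     if s == J then F else if K <= s then c else 1%g) ->
  PP p (v ++ wpow y M) = ((if J <= M then F else 1) * c ^+ (M.+1 - K))%g.
Proof.
move=> y0 JK; elim: M => [|M IH] h1 h2.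
  have -> : (J <= 0) = false by lia.
  have -> : 1 - K = 0 by lia.
  rewrite mul1g expg0 cats0; apply: prefix_prod_one => k kl; apply/eqP/negPn/negP.
  have := h1 k; rewrite cats0 addn0 => H /(H kl)[s s0 e].
  have : 0 < s * size y by rewrite muln_gt0 s0.
  by rewrite e in kl; slia.
have tk k j : k <= size v + M * size y ->
    take k (v ++ wpow y (M + j)) = take k (v ++ wpow y M).
  by move=> kl; rewrite wpowD catA takel_cat // size_cat size_wpow.
have sM : size v + M.+1 * size y = size v + M * size y + size y by rewrite mulSn; slia.
rewrite wpowSr catA prefix_prod_cat IH; last 2 first.
- move=> k /andP[k0 kl]; have := h1 k; rewrite -[in wpow y _]addn1 tk // k0 sM; apply.
  exact: leq_trans kl (leq_addr _ _).
- by move=> s sl; apply: h2; lia.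
rewrite prefix_prod_last; last 2 first.
- by rewrite -size_eq0 -lt0n.
- move=> k kl; apply/eqP/negPn/negP => ne.
  have [||s s0 e] := h1 (size v + M * size y + k).
  + by rewrite sM; slia.
  + suff -> : take (size v + M * size y + k) (v ++ wpow y M.+1) = (v ++ wpow y M) ++ take k y.
      by rewrite catA.
    by rewrite wpowSr catA take_cat size_cat size_wpow ltnNge leq_addr /= addKn.
  move: e; rewrite -addnA => /addnI e.
  have := congr1 (modn^~ (size y)) e; rewrite modnMDl modnMl modn_small; last by lia.
  by move: kl; case: k {ne e}.
have := h2 M.+1; rewrite wpowSr -!catA => -> //=.
have [e|ne] := eqVneq M.+1 J.
  have -> : (J <= M) = false by lia.
  have -> : (J <= M.+1) by lia.
  have [-> ->] : M.+1 - K = 0 /\ M.+2 - K = 0 by lia.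
  by rewrite !expg0 !mul1g mulg1.
have -> : (J <= M) = (J <= M.+1) by lia.
case: (leqP K M.+1) => KM; rewrite -mulgA.
  by rewrite (subSn KM) expgSr.
have [-> ->] : M.+1 - K = 0 /\ M.+2 - K = 0 by lia.
by rewrite !mulg1.
Qed.

(** A special word ending at or after the end of such a run cannot begin before the run, so
    neighbouring pairs of powers can be treated separately. *)
Definition long_exp M := forall w, special w -> size w <= M.

Lemma long_exp_kk M i : long_exp M -> i \in In D -> kk <= M.
Proof.
move=> bM iI; have /bM : special (wpow (x i) kk) by right; exists i.
by rewrite size_wpow; apply: leq_trans; rewrite leq_pmulr // x_gt0.
Qed.

Lemma seg_In v a b : seg v a b -> [/\ a \in In D, b \in In D & a <= b].
Proof. by case=> -[_ [-> ->]]; split; rewrite ?mem_In; lia. Qed.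

Lemma prefix_prod_left v a b M : seg v a b ->
  PP [::] (v ++ wpow (x a) M) = (g (inl (x a)) ^+ (M.+1 - kk))%g.
Proof.
move=> sg; have [aI _ _] := seg_In sg; have a0' := x_gt0 aI; have jk := jj_kk.
(* There is no transition before the first run: the value at [jj] is 1. *)
rewrite (@prefix_prod_powers [::] v (x a) M 1%g (g (inl (x a))) jj kk) //; last 3 first.
- by lia.
- move=> k kl /hval_neq1[w spw /suffixP[p e]].
  have e' : v ++ wpow (x a) M = p ++ w ++ drop k (v ++ wpow (x a) M).
    by rewrite catA -e cat_take_drop.
  have [_ [s [ks es]]] := special_left sg spw e'; exists s; first by lia.
  by rewrite -es -size_cat -e size_takel // size_cat size_wpow; case/andP: kl.
- move=> s sM; have [kks|skk] := leqP kk s.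
    have -> : (s == jj) = false by lia.
    rewrite (@hval_special (wpow (x a) kk)) ?fval_power //; first by right; exists a.
    by rewrite -(subnK kks) wpowD !catA suffix_suffix.
  rewrite hval_none ?if_same // => w spw /suffixP[p e].
  have e' : v ++ wpow (x a) s = p ++ w ++ [::] by rewrite cats0 -e.
  by have [_ [t [kt _]]] := special_left sg spw e'; lia.
by rewrite if_same mul1g.
Qed.

Lemma local_suffix y v Z w M : y != [::] -> long_exp M -> special w ->
  suffix w ((Z ++ wpow y M) ++ v) -> suffix w (wpow y M ++ v).
Proof.
move=> y0 bM spw; rewrite -catA => /suffix_cat_size; apply.
rewrite size_cat size_wpow (leq_trans (bM _ spw)) //.
by rewrite (leq_trans _ (leq_addr _ _)) // leq_pmulr // lt0n size_eq0.
Qed.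

(** The word of $W_{\mathbb j}$ ends with [tt + jj] copies of [x i.+1], and by the choice of [kk] it
    has no room for [kk] of them. Hence the transition is completed before the first power. *)
Lemma tt_jj_kk i : i \in Imn D -> jj + tt D jj i < kk.
Proof.
move=> iI; have [i1 i2] := Imn_In iI; rewrite ltnNge; apply/negP => le.
move/negP: (kk_nfactor i2 iI); apply; apply: suffixW.
apply: (@suffix_trans _ (wpow (x i.+1) (tt D jj i + jj))).
  by rewrite addnC -(subnK le) wpowD suffix_suffix.
case/suffixP: (tt_suffix i) => p e.
by rewrite /Wj_i /= catA e -catA -wpowD suffix_suffix.
Qed.

(** The first $x_{i+1}^{kk}$ is complete after only [kk - tt D jj i] copies of the run, because
    [tt D jj i] copies precede it. *)
Lemma prefix_prod_mid i Z Mi M : i \in Imn D -> long_exp Mi -> jj <= M ->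
  PP (Z ++ wpow (x i) Mi) (u i ++ wpow (x i.+1) M) =
  (fW D g jj i * g (inl (x i.+1)) ^+ (M.+1 - (kk - tt D jj i)))%g.
Proof.
move=> iI bM jM; have [i1 i2] := Imn_In iI; have tk := tt_jj_kk iI.
have y0 := x_gt0 i2; have x0 := x_neq0 i1; have jk := jj_kk.
have jMi : jj <= Mi by have := long_exp_kk bM i1; lia.
rewrite (@prefix_prod_powers _ (u i) (x i.+1) M (fW D g jj i) (g (inl (x i.+1))) jj (kk - tt D jj i)) ?jM //.
- by lia.
- move=> k kl /hval_neq1[w spw /(local_suffix x0 bM spw)/suffixP[p e]].
  have e' : wpow (x i) Mi ++ u i ++ wpow (x i.+1) M =
      p ++ w ++ drop k (u i ++ wpow (x i.+1) M).
    by rewrite [in RHS]catA -e -catA cat_take_drop.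
  have sz := congr1 size e; rewrite !size_cat size_wpow size_takel in sz; last first.
    by rewrite size_cat size_wpow; case/andP: kl.
  have [le|[_ es]|[_ [s [s0 _ es]]]] := special_mid iI jMi spw e'.
  + by move: kl; rewrite -sz in le; slia.
  + by exists jj; [lia | move: es; rewrite -sz -addnA => /addnI].
  + by exists s => //; move: es; rewrite -sz -addnA => /addnI.
- move=> s sM; have [es|sj] := eqVneq s jj.
    rewrite es (@hval_special (Wj_i D jj i)) ?fval_Wj //; first by left; exists i.
    by rewrite -(subnK jMi) wpowD -!catA catA suffix_suffix.
  have [kks|skk] := leqP (kk - tt D jj i) s.
    rewrite (@hval_special (wpow (x i.+1) kk)) ?fval_power //; first by right; exists i.+1.
    case/suffixP: (tt_suffix i) => p e.
    rewrite -(subnK jMi) wpowD -!catA [wpow (x i) jj ++ _]catA e -!catA -wpowD.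
    have le : kk <= tt D jj i + s by lia.
    by rewrite -(subnK le) wpowD !catA suffix_suffix.
  rewrite hval_none // => w spw /(local_suffix x0 bM spw)/suffixP[p e].
  have e' : wpow (x i) Mi ++ u i ++ wpow (x i.+1) s = p ++ w ++ [::] by rewrite cats0 -e.
  have sz := congr1 size e; rewrite !size_cat !size_wpow in sz.
  have pos : 0 < s * size (x i.+1) by rewrite muln_gt0 y0; lia.
  have [le|[_ es]|[_ [t [_ kt es]]]] := special_mid iI jMi spw e'.
  + by rewrite -sz in le; slia.
  + move: es; rewrite -sz addnA => /addnI/eqP.
    by rewrite eqn_pmul2r // (negbTE sj).
  + move: es; rewrite -sz addnA => /addnI/eqP; rewrite eqn_pmul2r // => /eqP ess.
    by lia.
Qed.

Lemma prefix_prod_right v a b Z M : seg v a b -> long_exp M -> PP (Z ++ wpow (x b) M) (u b) = 1%g.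
Proof.
move=> sg bM; have [_ bI _] := seg_In sg.
apply: prefix_prod_one => k kl; apply: hval_none => w spw.
move=> /(local_suffix (x_neq0 bI) bM spw)/suffixP[p e].
have e' : wpow (x b) M ++ u b = p ++ w ++ drop k (u b).
  by rewrite [in RHS]catA -e -catA cat_take_drop.
have [_ le] := special_right sg spw e'.
have sz := congr1 size e; rewrite !size_cat size_wpow size_takel in sz; last by case/andP: kl.
by rewrite -sz in le; slia.
Qed.

Section Segment.
Variable Mx : nat -> nat.
Hypothesis Mx_long : forall i, i \in In D -> long_exp (Mx i).
Hypothesis Mx_mod : forall i, i \in In D ->
  Mx i + qq D = qi D i %[mod #[g (inl (x i))]%g].

Definition seg_part v a k :=
  v ++ flatten [seq wpow (x i) (Mx i) ++ u i | i <- iota a k] ++ wpow (x (a + k)) (Mx (a + k)).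
Definition vpart a k : seq (var A) :=
  flatten [seq nseq (qi D i) (inl (x i)) ++ [:: inr (x i, u i, x i.+1)] | i <- iota a k]
  ++ nseq (qi D (a + k)) (inl (x (a + k))).

Lemma eta_cat z1 z2 : Defs.eta g (z1 ++ z2) = (Defs.eta g z1 * Defs.eta g z2)%g.
Proof. by elim: z1 => [|c z1 IH] /=; rewrite ?mul1g // IH mulgA. Qed.
Lemma eta_nseq k c : Defs.eta g (nseq k c) = (g c ^+ k)%g.
Proof. by elim: k => //= k ->; rewrite expgS. Qed.

(** Modulo the order, $-kk$ is $1+qq$, and [Mx i + qq] is $\mathbb q_i$. *)
Lemma power_exponent i t : i \in In D -> t <= kk ->
  (g (inl (x i)) ^+ ((Mx i).+1 - (kk - t)) = g (inl (x i)) ^+ (t + qi D i + 2))%g.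
Proof.
move=> iI tk; rewrite -[LHS]expg_mod_order -[RHS]expg_mod_order; congr (_ ^+ _)%g.
have kM := long_exp_kk (Mx_long iI) iI.
have /eqP h0 : (kk + 1 + qq D == 0 %[mod #[g (inl (x i))]%g])%N.
  by rewrite mod0n; case: kkP => _ _ /(_ i iI).
apply/eqP; rewrite -(eqn_modDr (kk + 1 + qq D)).
have -> : (Mx i).+1 - (kk - t) + (kk + 1 + qq D) = t + 2 + (Mx i + qq D) by lia.
apply/eqP; rewrite -[LHS]modnDmr (Mx_mod iI) modnDmr -[RHS]modnDmr h0 mod0n addn0.
by rewrite addnAC.
Qed.

Lemma seg_partS v a k : seg_part v a k.+1 =
  seg_part v a k ++ u (a + k) ++ wpow (x (a + k).+1) (Mx (a + k).+1).
Proof.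
rewrite /seg_part -addn1 iotaD map_cat flatten_cat /= addn1 addnS cats0 -!catA.
by [].
Qed.

Lemma vpartS a k : vpart a k.+1 = vpart a k ++
  inr (x (a + k), u (a + k), x (a + k).+1) :: nseq (qi D (a + k).+1) (inl (x (a + k).+1)).
Proof.
rewrite /vpart -addn1 iotaD map_cat flatten_cat /= addn1 addnS cats0 -!catA.
by [].
Qed.

(** The product telescopes: each [fW] absorbs the spare factor ending the run before it and leaves
    one spare factor at the end of the run after it. *)
Lemma prefix_prod_seg_part v a b k : seg v a b -> a + k <= b ->
  PP [::] (seg_part v a k) =
  (g (inl (x a)) * Defs.eta g (vpart a k) * g (inl (x (a + k))))%g.
Proof.
move=> sg; have [aI bI ab] := seg_In sg; have jk := jj_kk.
have inI i : a <= i <= b -> i \in In D by move: aI bI; rewrite !mem_In; lia.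
elim: k => [|k IH] kb.
  rewrite /seg_part /vpart /= !addn0 (prefix_prod_left _ sg) eta_nseq.
  have := power_exponent aI (leq0n kk); rewrite subn0 => ->.
  by rewrite add0n addn2 expgSr expgS.
have kI : a + k \in In D by apply: inI; lia.
have kI' : (a + k).+1 \in In D by apply: inI; lia.
have kM : a + k \in Imn D.
  rewrite mem_Imn; move: kI kI' kb; rewrite !mem_In.
  by case: sg => -[_ [ea eb]]; lia.
have tk := tt_jj_kk kM.
rewrite seg_partS prefix_prod_cat IH; last by lia.
rewrite cat0s {1}/seg_part catA prefix_prod_mid //; last 2 first.
- exact: Mx_long.
- by have := long_exp_kk (Mx_long kI') kI'; lia.
rewrite power_exponent //; last by lia.
have -> : tt D jj (a + k) + qi D (a + k).+1 + 2 =
          (tt D jj (a + k)).+1 + (qi D (a + k).+1).+1 by lia.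
rewrite vpartS eta_cat [a + k.+1]addnS expgD.
rewrite -[Defs.eta g (_ :: _)]/(g _ * Defs.eta g _)%g eta_nseq /fW.
by rewrite !mulgA mulgK mulgKV -[RHS]mulgA -expgSr.
Qed.

Lemma vblockE a b : a <= b -> vblock D a b = vpart a (b - a).
Proof.
move=> ab; rewrite /vblock /vpart -addn1 iotaD map_cat flatten_cat /= subnKC // ltnn !cats0.
congr (flatten _ ++ _); apply/eq_in_map => i; rewrite mem_iota => il.
by have -> : i < b by lia.
Qed.

Definition seg_word v a b :=
  v ++ flatten [seq wpow (x i) (Mx i) ++ u i | i <- iota a (b - a).+1].

Lemma seg_wordE v a b : a <= b -> seg_word v a b = seg_part v a (b - a) ++ u b.
Proof.
move=> ab; rewrite /seg_word /seg_part -addn1 iotaD map_cat flatten_cat /= subnKC //.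
by rewrite cats0 -!catA.
Qed.

Lemma prefix_prod_seg_word v a b : seg v a b -> PP [::] (seg_word v a b) =
  (g (inl (x a)) * Defs.eta g (vblock D a b) * g (inl (x b)))%g.
Proof.
move=> sg; have [aI bI ab] := seg_In sg.
rewrite seg_wordE // prefix_prod_cat (prefix_prod_seg_part sg) ?subnKC // vblockE //.
rewrite cat0s /seg_part subnKC // catA (prefix_prod_right _ sg) ?mulg1 //.
exact: Mx_long.
Qed.
End Segment.

(** * Finiteness and presentation of the model *)

Lemma x_occ i : i \in In D -> {subset x i <= occ D}.
Proof.
move=> iI a ax; rewrite !mem_cat; apply/or3P/Or33/flattenP.
by exists (x i ++ u i); [apply/mapP; exists i | rewrite mem_cat ax].
Qed.
Lemma u_occ i : i \in In D -> {subset u i <= occ D}.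
Proof.
move=> iI a ax; rewrite !mem_cat; apply/or3P/Or33/flattenP.
by exists (x i ++ u i); [apply/mapP; exists i | rewrite mem_cat ax orbT].
Qed.
Lemma seg_occ v a b : seg v a b -> {subset v <= occ D}.
Proof. by case=> -[-> _] c cv; rewrite !mem_cat cv ?orbT. Qed.

Lemma Lgen_occ w : w \in Lgen -> {subset w <= occ D}.
Proof.
have [[X U] V] := (x_occ, u_occ, seg_occ).
have L v a b : seg v a b -> {subset v ++ wpow (x a) ii <= occ D}.
  move=> sg c; have [aI _ _] := seg_In sg; rewrite mem_cat => /orP[/(V _ _ _ sg)//|].
  by move/mem_wpow/(X _ aI).
have R v a b : seg v a b -> {subset wpow (x b) ii ++ u b <= occ D}.
  move=> sg c; have [_ bI _] := seg_In sg; rewrite mem_cat => /orP[|/(U _ bI)//].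
  by move/mem_wpow/(X _ bI).
rewrite !mem_cat => /or3P[|/mapP[i iI ->]|].
- rewrite !inE /= => /or4P[]/eqP ->.
  + exact: L seg1.
  + exact: L seg2.
  + exact: R seg1.
  + exact: R seg2.
- have [i1 i2] := Imn_In iI; move: (occ D) X U {V L R} => O X U c; rewrite /Wj_i /= !mem_cat => /or3P[/mem_wpow||/mem_wpow].
  + exact: (X i i1).
  + exact: (U i i1).
  + exact: (X i.+1 i2).
- case/flattenP=> s /mapP[i iI ->] /mapP[r _ ->] c /mem_wpow; rewrite mem_rot.
  exact: (X i iI).
Qed.

Lemma Wi_inL w : w \in Wi D ii -> w != [::] -> inL w.
Proof.
move=> wW w0; rewrite inLE w0; apply/hasP; exists w; last exact: infix_refl.
by rewrite mem_cat wW.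
Qed.

Lemma seg_inL v a b : seg v a b -> inL (v ++ wpow (x a) ii) /\ inL (wpow (x b) ii ++ u b).
Proof.
move=> sg; have [aI bI _] := seg_In sg; have [w1 w2] := seg_Wi sg.
have ii0 : 0 < ii by have := size_bound; lia.
split; apply: Wi_inL => //; rewrite -size_eq0 size_cat size_wpow -lt0n.
  by rewrite ltn_addl // muln_gt0 ii0 x_gt0.
by rewrite ltn_addr // muln_gt0 ii0 x_gt0.
Qed.

Lemma inL_letter a : inL [:: a] = (a \in occ D).
Proof.
apply/idP/idP => [/andP[_ /hasP[W WL]]|]; first by rewrite infix1s => /(Lgen_occ WL).
have by_word w : inL w -> a \in w -> inL [:: a].
  by move=> wL aw; apply: inL_infix wL _ _; rewrite ?infix1s.
have by_seg v c b : seg v c b -> (a \in v) || (a \in u b) -> inL [:: a].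
  move=> sg /orP[]aw; have [l1 l2] := seg_inL sg.
    by apply: by_word l1 _; rewrite mem_cat aw.
  by apply: by_word l2 _; rewrite mem_cat aw orbT.
rewrite !mem_cat => /or3P[av|av|].
- by apply: (by_seg _ _ _ seg1); rewrite av.
- by apply: (by_seg _ _ _ seg2); rewrite av.
case/flattenP=> w /mapP[i iI ->]; rewrite mem_cat => /orP[ax|au].
  have sp : special (wpow (x i) kk) by right; exists i.
  apply: by_word (special_inL sp) _.
  by have := jj_kk; case: (kk) => // k _; rewrite wpowS mem_cat ax.
have [im|im] := eqVneq i m; first by apply: (by_seg _ _ _ seg1); rewrite -im au orbT.
have [ien|ien] := eqVneq i n; first by apply: (by_seg _ _ _ seg2); rewrite -ien au orbT.
have iM : i \in Imn D by rewrite mem_Imn im; move: iI; rewrite mem_In; lia.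
have sp : special (Wj_i D jj i) by left; exists i.
by apply: by_word (special_inL sp) _; rewrite /Wj_i /= !mem_cat au orbT.
Qed.

Definition factors : seq (seq A) :=
  flatten [seq [seq take j (drop i W) | i <- iota 0 (size W).+1, j <- iota 0 (size W).+1]
          | W <- Lgen].

Lemma inL_factors w : inL w -> w \in factors.
Proof.
case/andP=> _ /hasP[W WL /infixP[s [s' e]]]; apply/flattenP.
exists [seq take j (drop i W) | i <- iota 0 (size W).+1, j <- iota 0 (size W).+1].
  by apply/mapP; exists W.
apply/allpairsP; exists (size s, size w); split.
- by rewrite mem_iota /= e !size_cat; slia.
- by rewrite mem_iota /= e !size_cat; slia.
- by rewrite e drop_size_cat // take_size_cat.
Qed.

Lemma size_inL w : inL w -> size w <= \max_(W <- Lgen) size W.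
Proof.
case/andP=> _ /hasP[W WL /size_infix le]; apply: leq_trans le _.
exact: (@leq_bigmax_seq _ _ predT (fun W => size W)).
Qed.

Lemma relations_holdE (T : Type) (op : T -> T -> T) (iA : A -> T) (iG : gT -> T) :
  relations_hold D g ii jj kk op iA iG = relations inL fval op iA iG.
Proof. by []. Qed.

Lemma S_pres_local_group (T : Type) (op : T -> T -> T) (iA : A -> T) (iG : gT -> T) :
  associative op -> is_S_pres D g ii jj kk op iA iG -> local_group op.
Proof.
move=> opA [rel gens _]; rewrite relations_holdE in rel.
apply: (pres_local_group size_inL opA rel) => t.
have [z [z0 zo ez]] := gens t; exists z; split=> //.
apply: sub_all zo => -[a|k] //; by rewrite inL_letter.
Qed.

Local Notation mT := (model gT inL factors).
Local Notation mop := (@model_op _ _ _ inL fval factors).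
Local Notation mA := (model_A gT inL_factors).
Local Notation mG := (model_G inL_factors).

Lemma inL0 : inL [::] = false. Proof. by []. Qed.

Lemma model_S_pres : is_S_pres D g ii jj kk mop mA mG.
Proof.
split.
- rewrite relations_holdE; apply: model_relations => //.
  + exact: inL_infix.
  + exact: fval0.
  + exact: fval_forbidden.
- move=> t; have /andP[vt nt] := model_valid inL_factors t; exists (code (val t)); split.
  + exact: code_neq0.
  + have := code_letters inL_infix vt; apply: sub_all => -[a|k] //.
    by rewrite inL_letter.
  + exact: (model_gev fval inL_infix inL_factors t).
- move=> T' op' iA' iG' opA' rel; rewrite relations_holdE in rel.
  have [h [h1 h2 h3]] := model_universal inL_infix inL_factors fval0 opA' rel fval_forbidden.
  by exists h; split=> // a; rewrite -inL_letter; apply: h2.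
Qed.

Lemma model_assoc : associative mop.
Proof. exact: (model_opA fval inL_infix inL_factors). Qed.

(** Makes exponents computed from the size of the model long compared with the words of L: the
    prefixes of [w] are distinct elements. *)
Lemma card_model_inL w : inL w -> size w < #|{: mT}|.
Proof.
(* The empty prefix is not a state; it goes to the default [mG 1], to which [h] assigns 0. *)
move=> wL; pose f (i : 'I_(size w).+1) : mT := insubd (mG 1%g) (None, take i w).
pose h (t : mT) := if (val t).1 is None then size (val t).2 else 0.
have hf i : h (f i) = i.
  have il : i <= size w by rewrite -ltnS.
  have [i0|i0] := posnP i.
    by rewrite /f i0 take0 /insubd insubN // (mem_states inL_factors) /tvalid andbF.
  rewrite /f /h insubdK /= ?size_takel // -topredE /= (mem_states inL_factors) /tvalid /valid /= andbT.
  have t0 : take i w != [::] by rewrite -size_eq0 size_takel // -lt0n.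
  rewrite /inL1 (inL_infix wL) ?infix_take // orbT /=.
  by apply: contra t0 => /eqP[] ->.
have fi : injective f by move=> i j /(congr1 h); rewrite !hf; apply: val_inj.
by rewrite -[X in X <= _]card_ord; apply: leq_card fi.
Qed.

Lemma card_model_group (k : gT) : #[k]%g <= #|{: mT}|.
Proof.
apply: leq_trans (max_card _) _; apply: (leq_card mG) => a b.
by move/(congr1 val) => [].
Qed.

(** * The values of both terms in the model *)

Definition Mx i := omega_exp mT (q i).

Lemma Mx_ge i : #|{: mT}| <= Mx i.
Proof.
apply: (leq_trans (fact_geq _)); rewrite /Mx /omega_exp.
move: (#|{: mT}|)`! (fact_gt0 #|{: mT}|) => M M0; case: (q i) => k; first by lia.
by apply: leq_trans (leq_pmulr _ _); lia.
Qed.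

Lemma Mx_long i : long_exp (Mx i).
Proof.
move=> w /special_inL/card_model_inL/ltnW le; exact: leq_trans le (Mx_ge i).
Qed.

Lemma abs_q_lt i : i \in In D -> absz (q i) < qq D.
Proof. by move=> iI; rewrite /qq ltnS (leq_bigmax_seq (F := fun i => absz (q i))). Qed.

(** The group embeds in the model, so every order divides the factorial that enters the exponent. *)
Lemma Mx_mod i : i \in In D -> Mx i + qq D = qi D i %[mod #[g (inl (x i))]%g].
Proof.
move=> iI; have := abs_q_lt iI; rewrite /qi /Mx /omega_exp /=.
have : #[g (inl (x i))]%g %| (#|{: mT}|)`!.
  by apply: dvdn_fact; rewrite order_gt0 card_model_group.
move: (#|{: mT}|)`! (fact_gt0 #|{: mT}|) (qq D) #[_]%g => M M0 Q o /dvdnP[c eM] lt.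
suff [e ->] : exists e, (match q i with Posz k => 2 * M - 1 + k.+1
                                     | Negz k => (2 * M - 1) * k.+1 end) + Q =
    e * M + `|(Posz Q + q i)%R|%N.
  by rewrite eM mulnA modnMDl.
case: (q i) lt => k lt; first by exists 2; lia.
exists (2 * k.+1).
have -> : (2 * M - 1) * k.+1 = 2 * k.+1 * M - k.+1 by rewrite mulnBl mul1n mulnAC.
have : k.+1 <= 2 * k.+1 * M by rewrite mulnAC leq_pmull // muln_gt0.
by move: (2 * k.+1 * M) => K; lia.
Qed.

Lemma seg_word_inL v a b : seg v a b -> inL (seg_word Mx v a b) = false.
Proof.
move=> sg; apply/negP => /card_model_inL; rewrite ltnNge; have [aI _ _] := seg_In sg.
case/negP; apply: leq_trans (Mx_ge a) _.
rewrite /seg_word /= !size_cat size_wpow.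
by have := leq_pmulr (Mx a) (x_gt0 aI); slia.
Qed.

(** A prefix of [w] in L cannot contain the letter at which L is first left. *)
Lemma prefix_of_overflow z w p : inL z -> inL1 inL p -> prefix z w ->
  (exists2 a, prefix (rcons p a) w & ~~ inL (rcons p a)) -> prefix z p.
Proof.
move=> zL pL /prefixP[r e] [a /prefixP[r' e'] nb].
have [le|lt] := leqP (size z) (size p).
  apply: (@prefix_cat_size _ _ _ _ (a :: r')) => //.
  by rewrite -cat_rcons -e' e prefix_prefix.
have : prefix (rcons p a) z.
  apply: (@prefix_cat_size _ _ _ _ r); last by rewrite size_rcons.
  by rewrite -e e' prefix_prefix.
by move/prefixW/(inL_infix zL); rewrite (negbTE nb) -size_eq0 size_rcons => /(_ isT).
Qed.

(** The middle is found by cancelling [fval P] and [fval S] from the total product. If [v] is empty,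
    [P] has the maximal word [wpow (x a) kk] as a prefix and so equals it. If not, a special [P]
    would start with [v] and yet be too short to end [kk] copies after it. The right end is
    similar. *)
Lemma seg_run v a b : seg v a b -> exists P S,
  [/\ run inL fval (triv A gT) (map inl (seg_word Mx v a b)) = 
        (Some (P, Defs.eta g ((if v != [::] then [:: inl (x a)] else [::]) ++
           vblock D a b ++ (if u b != [::] then [:: inl (x b)] else [::]))), S),
      prefix (v ++ wpow (x a) ii) P & suffix (wpow (x b) ii ++ u b) S].
Proof.
move=> sg; have [aI bI ab] := seg_In sg; set W := seg_word Mx v a b.
have jk := jj_kk; have [L1 L2] := seg_inL sg.
have kMa := long_exp_kk (@Mx_long a) aI; have kMb := long_exp_kk (@Mx_long b) bI.
have [za eW] : exists za, W = v ++ wpow (x a) (Mx a) ++ za.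
  by rewrite /W /seg_word /=; eexists; rewrite -catA.
have [zb eW'] : exists zb, W = zb ++ wpow (x b) (Mx b) ++ u b.
  rewrite /W seg_wordE // /seg_part subnKC //.
  by eexists (_ ++ _); rewrite -!catA.
have nL := seg_word_inL sg; rewrite -/W in nL.
have := run_prefix fval W inL0; have := run_suffix2 fval inL_infix W inL0.
have := group_value_run inL_infix fval_maximal W inL0 fval0.
rewrite (prefix_prod_seg_word (fun i _ => @Mx_long i) Mx_mod sg).
case: (run _ _ _ _) => -[[P c]|] S /=; last first.
  have W0 : W != [::].
    rewrite eW -size_eq0 !size_cat size_wpow.
    by have := leq_pmulr (Mx a) (x_gt0 aI); slia.
  by move=> _ _ [_]; rewrite /inL1 (negbTE W0) nL.
rewrite /group_value /= => tot eS [pL [l pw nb]].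
have pz z : inL z -> prefix z W -> prefix z P.
  by move=> zL zW; apply: prefix_of_overflow zL pL zW _; exists l.
have fP : fval P = Defs.eta g (if v != [::] then [::] else [:: inl (x a)]).
  have [v0|v0] := eqVneq v [::] => /=.
    have spa : special (wpow (x a) kk) by right; exists a.
    have xP : prefix (wpow (x a) kk) P.
      apply: pz; first exact: special_inL.
      by rewrite eW v0 -(subnKC kMa) wpowD /= -catA prefix_prefix.
    have PL : inL P.
      case/orP: pL => // /eqP P0; move: xP; rewrite P0 prefixs0 => /eqP e.
      by have := special_inL spa; rewrite e.
    by rewrite (special_maximal spa PL (prefixW xP)) fval_power // mulg1.
  apply/eqP/negPn/negP => /fval_special spP.
  have : prefix P (v ++ wpow (x a) (Mx a)).
    apply: (@prefix_cat_size _ _ _ _ za).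
      by rewrite -catA -eW; apply: prefix_trans (prefix_rcons _ _) pw.
    rewrite size_cat size_wpow (leq_trans (Mx_long a spP)) //.
    by rewrite (leq_trans (leq_pmulr _ (x_gt0 aI))) // leq_addl.
  case/prefixP=> r e; have [eP [s [/andP[ks _] es]]] := special_left sg spP (p := [::]) e.
  move: es; rewrite eP size_wpow add0n => es.
  have : kk * size (x a) <= s * size (x a) by rewrite leq_mul2r ks orbT.
  by move: v0; rewrite -size_eq0; slia.
have fS : fval S = Defs.eta g (if u b != [::] then [::] else [:: inl (x b)]).
  rewrite eS -/(hval W); have [u0|u0] := eqVneq (u b) [::] => /=.
    have spb : special (wpow (x b) kk) by right; exists b.
    rewrite (hval_special spb) ?fval_power ?mulg1 //.
    by rewrite eW' u0 cats0 -(subnK kMb) wpowD catA suffix_suffix.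
  apply: hval_none => w spw; rewrite eW' catA.
  move=> /(local_suffix (x_neq0 bI) (@Mx_long b) spw)/suffixP[p e].
  have e' : wpow (x b) (Mx b) ++ u b = p ++ w ++ [::] by rewrite cats0.
  have [_ le] := special_right sg spw e'.
  have := congr1 size e; rewrite !size_cat size_wpow.
  by move: u0; rewrite -size_eq0; slia.
exists P, S; split.
- move: (vblock D a b) tot => VB tot; congr (Some (_, _), _); rewrite !eta_cat.
  apply: (mulgI (fval P)); apply: (mulIg (fval S)); rewrite tot fP fS.
  by case: (v != [::]); case: (u b != [::]); rewrite /= !(mulg1, mul1g) ?mulgA.
- apply: pz => //; rewrite eW.
  have le : ii <= Mx a by lia.
  by rewrite -(subnKC le) wpowD -!catA catA prefix_prefix.
- rewrite eS; apply: lsuf_max; first by rewrite /inL1 L2 orbT.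
  have le : ii <= Mx b by lia.
  by rewrite eW' -(subnK le) wpowD -!catA catA suffix_suffix.
Qed.

Lemma seg_letters v a b : seg v a b ->
  good_letters inL (map inl (seg_word Mx v a b) : seq (A + gT)).
Proof.
move=> sg; have [aI bI ab] := seg_In sg; rewrite good_word; apply/allP => c.
rewrite inL_letter mem_cat => /orP[/(seg_occ sg)//|/flattenP[w /mapP[i]]].
rewrite mem_iota => il ->.
have iI : i \in In D by move: aI bI; rewrite !mem_In; lia.
by rewrite mem_cat => /orP[/mem_wpow/(x_occ iI)|/(u_occ iI)].
Qed.

Lemma seg_kevals v a b : seg v a b ->
  kevals mop mA (build v (blocks D a b)) = wprod mop mA (seg_word Mx v a b).
Proof.
move=> sg; have [aI bI ab] := seg_In sg; rewrite kevals_build; last 2 first.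
- exact: model_assoc.
- apply/allP => _ /mapP[i il ->] /=; apply: x_neq0; move: il aI bI.
  by rewrite mem_iota !mem_In; lia.
by rewrite /blocks -map_comp.
Qed.

Lemma seg_model v a b : seg v a b -> exists2 t : mT,
  kevals mop mA (build v (blocks D a b)) = Some t &
  val t = run inL fval (triv A gT) (map inl (seg_word Mx v a b)).
Proof.
move=> sg; have [|t e et] := gev_model fval inL_infix inL_factors (seg_letters sg).
  have [P [S [e _ _]]] := seg_run sg; apply/eqP => W0.
  by move: e; rewrite W0.
by exists t => //; rewrite seg_kevals // -(gev_word _ _ mG).
Qed.

Lemma model_separates : satisfies (T := mT) mop (kpi D) (krho D) ->
  [/\ Defs.eta g (wpi D) = Defs.eta g (wrho D), u0' = um' & u m = u n].
Proof.
move=> /(_ mA) sat.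
have [t1 k1 v1] := seg_model seg1; have [t2 k2 v2] := seg_model seg2.
have [P1 [S1 [e1 p1 s1]]] := seg_run seg1; have [P2 [S2 [e2 p2 s2]]] := seg_run seg2.
have : Some t1 = Some t2 by rewrite -k1 -k2; exact: sat.
case=> et; move: v1 v2; rewrite et e1 e2 => -> [eP eE eS].
rewrite eP in p1; rewrite eS in s1.
have [aI bI _] := seg_In seg1; have [aI' bI' _] := seg_In seg2.
have [n1 _ _ n1'] := seg_canonical seg1; have [n2 _ _ n2'] := seg_canonical seg2.
have sb := size_bound; split.
- exact: eE.
- apply: (prefix_power_inj a0 (lyndon_x aI) (lyndon_x aI') n1 n2 _ p1 p2).
  have ne : 1 != m.+1 by rewrite eq_sym eqSS -lt0n; case/andP: mn.
  have bx : size (x 1) + size (x m.+1) <= sum_size_x.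
    exact (sum2_le (fun i => size (x i)) (iota_uniq _ _) aI aI' ne).
  have bu : size u0' + size um' <= sum_size_u by apply: leq_addr.
  by rewrite -addnA (leq_trans (leq_add bu bx)) // addnC ltnW.
- apply: (suffix_power_inj a0 (lyndon_x bI) (lyndon_x bI') n1' n2' _ s1 s2).
  have ne : m != n by rewrite neq_ltn; case/andP: mn => _ ->.
  have bx : size (x m) + size (x n) <= sum_size_x.
    exact (sum2_le (fun i => size (x i)) (iota_uniq _ _) bI bI' ne).
  have bu : size (u m) + size (u n) <= sum_size_u.
    apply: leq_trans (leq_addl _ _).
    exact (sum2_le (fun i => size (u i)) (iota_uniq _ _) bI bI' ne).
  by rewrite -addnA (leq_trans (leq_add bu bx)) // addnC ltnW.
Qed.

(** * Reading the terms back from their words of variables *)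

Lemma nseq_inl_inj k k' y y' t t' (z z' : seq (var A)) :
  nseq k (inl y) ++ inr t :: z = nseq k' (inl y') ++ inr t' :: z' ->
  [/\ k = k', t = t' & z = z'].
Proof. by elim: k k' => [|k IH] [|k'] //= [] => [-> ->//|_ /IH[-> -> ->]]. Qed.

Lemma nseq_inl_neq k k' y y' t (z : seq (var A)) :
  nseq k (inl y) ++ inr t :: z <> nseq k' (inl y').
Proof. by elim: k k' => [|k IH] [|k'] //= [] _ /IH. Qed.

Lemma qi_gt0 i : i \in In D -> 0 < qi D i.
Proof. by move=> /abs_q_lt; rewrite /qi /=; move: (qq D) => Q; lia. Qed.

Lemma qi_inj i i' : i \in In D -> i' \in In D -> qi D i = qi D i' -> q i = q i'.
Proof. by move=> /abs_q_lt h /abs_q_lt h'; move: h h'; rewrite /qi /=; move: (qq D) => Q; lia. Qed.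

Lemma vpartSl a k : vpart a k.+1 =
  nseq (qi D a) (inl (x a)) ++ inr (x a, u a, x a.+1) :: vpart a.+1 k.
Proof. by rewrite /vpart /= addSnnS -!catA. Qed.

(** The letters [inr] delimit the blocks and carry the words. The last block has no such letter, but
    its exponent is positive because [qq] exceeds every $|q_i|$, so its [x] can still be read. *)
Lemma vpart_inj a a' k k' : (forall i, a <= i <= a + k -> i \in In D) ->
  (forall i, a' <= i <= a' + k' -> i \in In D) -> vpart a k = vpart a' k' ->
  k = k' /\ forall j, j <= k ->
    [/\ x (a + j) = x (a' + j), q (a + j) = q (a' + j) & j < k -> u (a + j) = u (a' + j)].
Proof.
elim: k k' a a' => [|k IH] [|k'] a a' aI aI'.
- rewrite /vpart /= !addn0 => e; split=> // -[|//] _; rewrite !addn0.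
  have a1 : a \in In D by apply: aI; lia.
  have a1' : a' \in In D by apply: aI'; lia.
  have := congr1 size e; rewrite !size_nseq => eq.
  have := qi_gt0 a1; move: e; rewrite eq; case E: (qi D a') => [|l] // [ex _] _.
  by split=> //; apply: qi_inj.
- by rewrite vpartSl /vpart /= addn0 => /esym/nseq_inl_neq.
- by rewrite vpartSl /vpart /= addn0 => /nseq_inl_neq.
have a1 : a \in In D by apply: aI; lia.
have a1' : a' \in In D by apply: aI'; lia.
rewrite !vpartSl => /nseq_inl_inj[eq [ex eu _] /IH[||-> h]].
- by move=> i il; apply: aI; lia.
- by move=> i il; apply: aI'; lia.
split=> // -[_|j jk]; first by rewrite !addn0; split=> //; apply: qi_inj.
by have := h j jk; rewrite !addSnnS.
Qed.

Lemma cat_inj_size (S : Type) (s1 s2 t1 t2 : seq S) :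
  size t1 = size t2 -> s1 ++ t1 = s2 ++ t2 -> s1 = s2.
Proof.
move=> et e; have es : size s1 = size s2.
  by have := congr1 size e; rewrite !size_cat et => /addIn.
by have := congr1 (take (size s1)) e; rewrite take_size_cat // es take_size_cat.
Qed.

Lemma terms_eq : wpi D = wrho D -> u0' = um' -> u m = u n -> kpi D = krho D.
Proof.
rewrite /wpi /wrho /kpi /krho /= => ew e0 en; move/eqP: ew.
have [aI bI ab] := seg_In seg1; have [aI' bI' ab'] := seg_In seg2.
(* As the end words agree, the optional first and last letters are present on both sides or on
   neither, and can be stripped by size. *)
have sz (b : bool) (y y' : var A) :
  size (if b then [:: y] else [::]) = size (if b then [:: y'] else [::]) by case: b.
rewrite eqseq_cat; last by rewrite e0; apply: sz.
case/andP=> _ /eqP/cat_inj_size ev; have {}ev := ev ltac:(rewrite en; apply: sz).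
move: ev; rewrite !vblockE // => /vpart_inj[||ek h].
- by move=> i; move: aI bI; rewrite !mem_In; lia.
- by move=> i; move: aI' bI'; rewrite !mem_In; lia.
rewrite e0; congr (build _ _); have iE c K : iota c K = map (addn c) (iota 0 K) by rewrite -iotaDl addn0.
rewrite /blocks -ek (iE 1) (iE m.+1) -!map_comp.
apply/eq_in_map => j; rewrite mem_iota add0n ltnS => /andP[_ jk].
have [ex eq eu] := h j jk; rewrite /= ex eq; congr (_, _, _).
(* No variable records the last [u]; there the equality is the hypothesis [u m = u n]. *)
move: jk; rewrite leq_eqVlt => /orP[/eqP ->|/eu//].
by rewrite {2}ek !subnKC.
Qed.

End Rank1.

Theorem theorem1 (d : Order.disp_t) (A : orderType d)
    (m n : nat) (u0' um' : seq A) (x u : nat -> seq A) (q : nat -> int) :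
  let D := RData m n u0' um' x u q in
  0 < m < n ->
  (forall i, 0 < i <= n -> x i != [::]) ->
  canonical u0' (blocks D 1 m) ->
  canonical um' (blocks D m.+1 n) ->
  forall (gT : finGroupType) (g : var A -> gT) (ii jj kk : nat),
  eta_ok D g -> ii_ok D ii -> jj_ok D ii jj -> kk_ok D g jj kk ->
  [<-> (forall (T : finType) (op : T -> T -> T),
          associative op -> satisfies op (kpi D) (krho D));
       (forall (T : finType) (op : T -> T -> T),
          associative op -> local_group op -> satisfies op (kpi D) (krho D));
       (forall (T : finType) (op : T -> T -> T) (iA : A -> T) (iG : gT -> T),
          associative op -> is_S_pres D g ii jj kk op iA iG ->
          satisfies op (kpi D) (krho D));
       [/\ wpi D = wrho D, u0' = um' & u m = u n];
       kpi D = krho D].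
Proof.
move=> D mn xn can1 can2 gT g ii jj kk [_ gsep] iiP [ij _] kkP.
(* A letter is needed as the default value of [nth]. *)
have [a0 _] : exists a : A, True.
  have : x 1 != [::] by apply: xn; lia.
  by case: (x 1) => // a; exists a.
tfae.
- by move=> h T op opA _; apply: h.
- move=> h T op iA iG opA pres; apply: h => //.
  exact: (S_pres_local_group mn can1 can2 iiP ij kkP opA pres).
- move=> h.
  have [e e0 en] := model_separates a0 mn can1 can2 iiP ij kkP
    (h _ _ _ _ (model_assoc g mn ij) (model_S_pres mn can1 can2 iiP ij kkP)).
  split=> //; apply/eqP/negPn/negP => /gsep; rewrite /D e.
  by rewrite eqxx.
- by case=> ew e0 en; apply: (terms_eq mn ij ew e0 en).
- by move=> e T op _ phi; rewrite e.
Qed.
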